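(* Let $K,M,M_1>0$ be rational, $n\ge1$, and let $a\in(0,\frac{K}{M(1+nM_1)}]$ be rational. For any fixed rational partition $Q\in\mathcal{P}_{\mathbb{Q}}$ of $[0,a]$, the map $$F_{(\cdot,\cdot)}(Q)(\cdot):\ \mathcal{V}^1\times\mathcal{W}_{\mathcal{D}}\to\mathcal{W}_{\mathcal{D}},\qquad ((u,u'),\phi)\mapsto F_{(u,u')}(Q)(\phi),$$ is computable.
   Context: **Partitions.** A partition of $[0,a]$ is $Q=(q_0,\dots,q_k)$ with $k\ge1$, $0=q_0<\dots<q_k=a$; $\Delta_j=q_{j+1}-q_j$. $\mathcal{P}_{\mathbb{Q}}$ is the set of partitions all of whose points are rational. **Order and interval notation.** In a dcpo, $x\ll y$ means: for every directed set $X$ with $y\sqsubseteq\bigsqcup X$ there is $d\in X$ with $x\sqsubseteq d$. For a box $R\subseteq\mathbb{R}^m$, $\mathbf{I}R$ is the set of non-empty compact boxes (products of closed intervals) contained in $R$, ordered by reverse inclusion, with the Scott topology. $A\Rightarrow B$ is the domain of Scott-continuous maps, ordered pointwise. $\alpha\oplus r$ is the Minkowski sum $\alpha+[-r,r]^n$. For $X\subseteq\mathbb{R}^n$, $T_{K,n}(X)=X\cap[-K,K]^n$. Arithmetic on boxes, interval matrices and interval vectors is interval arithmetic; integrals of interval functions are taken by integrating lower and upper bounds. **$\mathcal{V}^1$.** For $h:[-K,K]^n\to\mathbb{R}$, $O$ relatively open and $b\subseteq\mathbb{R}^n$ a compact box (or $b=\mathbb{R}^n$), write $h\in\delta(O,b)$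 if for all $x,y\in O$, $h(x)-h(y)\in\{\langle c,x-y\rangle: c\in b\}$. The $\overline{L}$-derivative is $\overline{L}(h)(x)=\bigcap\{b: x\in O,\ h\in\delta(O,b)\}$; for $h=(h_1,\dots,h_n)$, $\overline{L}(h)(x)$ is the $n\times n$ interval matrix with rows $\overline{L}(h_i)(x)$. The canonical interval extension $\boldsymbol{I}g$ of a (point- or set-valued) map $g$ sends a box $\alpha$ to the smallest box containing $\bigcup_{x\in\alpha}g(x)$. $\mathcal{V}^1$ is the set of pairs $(u,u')$ with $u\in\mathbf{I}[-K,K]^n\Rightarrow\mathbf{I}[-M,M]^n$, $u'\in\mathbf{I}[-K,K]^n\Rightarrow\mathbf{I}[-M_1,M_1]^{n^2}$, ordered pointwise, which are consistent: there is $h:[-K,K]^n\to[-M,M]^n$ with $u\sqsubseteq\boldsymbol{I}h$ and $u'\sqsubseteq\boldsymbol{I}\overline{L}(h)$. It is an $\omega$-continuous domain. $(u'\cdot u)(\beta)$ is the product of the interval matrix $u'(\beta)$ with the interval vector $u(\beta)$. **$\mathcal{D}_{\mathbb{Q}}$ and $\mathcal{W}_{\mathcal{D}}$.** $[0,a]_{(\mathbb{Q}]}$ is $[0,a]$ with the topology with base $\{(p,q]\cap[0,a]: p,q\in\mathbb{Q}\}$. $\mathcal{D}_{\mathbb{Q}}$ is the dcpo of continuous maps $[0,a]_{(\mathbb{Q}]}\to\mathbf{I}[-K,K]^n$, ordered pointwise. $\mathcal{B}_{\mathcal{D}}$ is the set of step functions $\bigsqcup_{i\in I}b_i\chi_{O_i}$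 in $\mathcal{D}_{\mathbb{Q}}$, $I$ finite, $O_i=(p_i,r_i]\cap[0,a]$ with $p_i,r_i\in\mathbb{Q}$, $b_i$ a box with rational coordinates; $b\chi_O$ equals $b$ on $O$ and $[-K,K]^n$ elsewhere. On $\mathcal{B}_{\mathcal{D}}$: $\bigsqcup_{i\in I}b_i\chi_{O_i}\vartriangleleft_{\mathcal{D}}\theta'$ iff for all $i\in I$ and $x\in O_i$, $b_i\ll\theta'(x)$. For arbitrary $f,g:[0,a]\to\mathbf{I}[-K,K]^n$: $f\vartriangleleft_{\mathcal{D}}g$ iff $f\sqsubseteq\theta_1\vartriangleleft_{\mathcal{D}}\theta_2\sqsubseteq g$ for some $\theta_1,\theta_2\in\mathcal{B}_{\mathcal{D}}$. $\mathcal{W}_{\mathcal{D}}$ is the set of rounded ideals of $(\mathcal{B}_{\mathcal{D}},\vartriangleleft_{\mathcal{D}})$ ordered by inclusion (a rounded ideal is a non-empty subset $\phi\subseteq\mathcal{B}_{\mathcal{D}}$ which is a lower set for $\vartriangleleft_{\mathcal{D}}$ and such that each finite $A\subseteq\phi$ has $z\in\phi$ with $x\vartriangleleft_{\mathcal{D}}z$ for all $x\in A$). For $f\in\mathcal{D}_{\mathbb{Q}}$, $f_*=\{b\in\mathcal{B}_{\mathcal{D}}: b\vartriangleleft_{\mathcal{D}}f\}$; for $\phi\in\mathcal{W}_{\mathcal{D}}$, $\phi^*=\bigsqcup_{b\in\phi}b\in\mathcal{D}_{\mathbb{Q}}$. For $b\in\mathcal{B}_{\mathcal{D}}$, $i_{\mathcal{D}}(b)=\{x\in\mathcal{B}_{\mathcal{D}}: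 x\vartriangleleft_{\mathcal{D}}b\}$; $i_{\mathcal{D}}(\mathcal{B}_{\mathcal{D}})$ is a countable basis of the $\omega$-continuous domain $\mathcal{W}_{\mathcal{D}}$. **Operators $\Phi$ and $F$.** The operator $\Phi:\mathcal{P}_{\mathbb{Q}}\times\mathcal{V}^1\to\mathcal{D}_{\mathbb{Q}}\to([0,a]\to\mathbf{I}[-K,K]^n)$ is defined by $\Phi_{(u,u')}(Q)(\phi)=y_\phi$, where $y_\phi(0)=(0,\dots,0)$ and, for $q_j<x\le q_{j+1}$, $$y_\phi(x)=T_{K,n}\Big[\phi(q_j)+\int_{q_j}^x u(\phi(q_j))+(t-q_j)\,(u'\cdot u)\big(T_{K,n}(\phi(q_j)\oplus M\Delta_j)\big)\,dt\Big].$$ The operator $F:\mathcal{P}_{\mathbb{Q}}\times\mathcal{V}^1\to\mathcal{W}_{\mathcal{D}}\to\mathcal{W}_{\mathcal{D}}$ is defined, for every $Q\in\mathcal{P}_{\mathbb{Q}}$, $(u,u')\in\mathcal{V}^1$ and $\phi\in\mathcal{W}_{\mathcal{D}}$, by $F_{(u,u')}(Q)(\phi)=\big(\Phi_{(u,u')}(Q)(\phi^* )\big)_*$. **Computability.** An $\omega$-continuous domain with an enumerated countable basis $\{d_0=\bot,d_1,\dots\}$ is effectively given if $\{(i,j)\in\mathbb{N}^2: d_i\ll d_j\}$ is recursively enumerable. Effective enumerations are fixed: $\mathcal{B}_{\mathcal{D}}=\{b_0,b_1,\dots\}$, giving the enumerated basis $\{i_{\mathcal{D}}(b_0),i_{\mathcal{D}}(b_1),\dots\}$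 of $\mathcal{W}_{\mathcal{D}}$; and $\{(u_0,u_0'),(u_1,u_1'),\dots\}$, an effectively enumerated basis of $\mathcal{V}^1$ consisting of the consistent pairs of step functions built from rational boxes (finite suprema of $b\chi_{\Uparrow c}$ with $b,c$ rational boxes and $\Uparrow c=\{\alpha: c\ll\alpha\}$, where $b\chi_{\Uparrow c}$ equals $b$ on $\Uparrow c$ and the bottom element elsewhere). For effectively given domains $D,E$ with enumerated bases $\{d_j\}$, $\{e_i\}$, a map $f:D\to E$ is computable iff $\{(i,j)\in\mathbb{N}^2: e_i\ll f(d_j)\}$ is recursively enumerable. For the present map, this set is $\{(i,j,k)\in\mathbb{N}^3: i_{\mathcal{D}}(b_i)\ll F_{(u_k,u_k')}(Q)(i_{\mathcal{D}}(b_j))\}$.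
   Formalization: Where the intersection X ∩ [-K,K]^n defining T_{K,n}(X) is empty (as for n=1, u={M/2}, u'={0}, φ={K}), so that Φ is undefined, T_{K,n}(X) is taken to be the image of X under nearest-point projection onto the cube; otherwise it is the intersection. *)

(* Defs.v *)
From HB Require Import structures.
From mathcomp Require Import all_boot all_order all_algebra.
From mathcomp Require Import all_classical all_reals all_analysis.
Set Implicit Arguments.
Unset Strict Implicit.
Unset Printing Implicit Defensive.
Import Order.TTheory GRing.Theory Num.Theory.
Import numFieldNormedType.Exports.
Local Open Scope classical_set_scope.
Local Open Scope ring_scope.

(* Codes are untyped in arity: [c] denotes, for every [m], the partial function
   of [m] arguments whose graph is [reval c] on argument lists of size [m]. *)
Inductive rcode : Type :=
| RZero
| RSucc
| RProj of nat
| RComp of rcode & seq rcode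
| RPrec of rcode & rcode
| RMin of rcode.

Inductive reval : rcode -> seq nat -> nat -> Prop :=
| reval_zero s : reval RZero s 0%N
| reval_succ x s : reval RSucc (x :: s) x.+1
| reval_proj i s : (i < size s)%N -> reval (RProj i) s (nth 0%N s i)
| reval_comp f gs s ys y :
    revals gs s ys -> reval f ys y -> reval (RComp f gs) s y
| reval_prec0 f g s y : reval f s y -> reval (RPrec f g) (0%N :: s) y
| reval_precS f g m s z y :
    reval (RPrec f g) (m :: s) z -> reval g [:: m, z & s] y ->
    reval (RPrec f g) (m.+1 :: s) y
| reval_min f s m (z : nat -> nat) :
    (forall k, (k < m)%N -> reval f (k :: s) (z k).+1) ->
    reval f (m :: s) 0%N -> reval (RMin f) s m
with revals : seq rcode -> seq nat -> seq nat -> Prop :=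
| revals_nil s : revals [::] s [::]
| revals_cons g gs s y ys :
    reval g s y -> revals gs s ys -> revals (g :: gs) s (y :: ys).

Definition recursive1 (f : nat -> nat) : Prop :=
  exists c, forall i, reval c [:: i] (f i).

Definition recursive2 (f : nat -> nat -> nat) : Prop :=
  exists c, forall i l, reval c [:: i; l] (f i l).

(* Recursively enumerable = domain of a partial recursive function. *)
Definition re3 (A : nat -> nat -> nat -> Prop) : Prop :=
  exists c, forall i j k, A i j k <-> exists y, reval c [:: i; j; k] y.

Definition computable_rat (x : nat -> nat -> rat) : Prop :=
  exists s m d : nat -> nat -> nat,
    [/\ recursive2 s, recursive2 m, recursive2 d &
      forall i l, x i l = (-1) ^+ s i l * (m i l)%:R / (d i l).+1%:R].

(* [C] is the carrier, a set of elements of [T]. *)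
Section Order.
Context {T : Type}.
Implicit Types (C X U : set T) (le : T -> T -> Prop).

Definition directed le X : Prop :=
  X !=set0 /\
  forall x y, X x -> X y -> exists z, [/\ X z, le x z & le y z].

Definition is_lub C le X s : Prop :=
  [/\ C s, forall x, X x -> le x s
    & forall t, C t -> (forall x, X x -> le x t) -> le s t].

Definition way_below C le x y : Prop :=
  forall X s, X `<=` C -> directed le X -> is_lub C le X s -> le y s ->
    exists2 d, X d & le x d.

Definition scott_open le U : Prop :=
  (forall x y, U x -> le x y -> U y) /\
  (forall X s, directed le X -> is_lub setT le X s -> U s ->
     exists2 d, X d & U d).

End Order.

Definition scott_continuous {T T' : Type} (le : T -> T -> Prop)
    (le' : T' -> T' -> Prop) (f : T -> T') : Prop :=
  forall U, scott_open le' U -> scott_open le (f @^-1` U).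

Definition pointwise {X T : Type} (le : T -> T -> Prop) (f g : X -> T) : Prop :=
  forall x, le (f x) (g x).

(* [f] is the step function, supremum of the [b l] chi_(O l) for [l < N]. *)
Definition is_step {X T : Type} (le : T -> T -> Prop) (bot : T)
    (N : nat) (O : nat -> set X) (b : nat -> T) (f : X -> T) : Prop :=
  is_lub setT (pointwise le)
    [set (fun x => if `[< O l x >] then b l else bot) | l in `I_N] f.

Definition computable2 {D E G : Type} (C : set G) (le : G -> G -> Prop)
    (d : nat -> D) (e : nat -> E) (g : nat -> G) (f : D -> E -> G) : Prop :=
  re3 (fun i j k => way_below C le (g i) (f (d k) (e j))).

(* Vectors are columns ['cV_n = 'M_(n, 1)]; interval matrices and interval
   vectors are both boxes of matrices. *)
Section Boxes.
Context {R : realType}.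

Record box (p q : nat) := Box {
  lo : 'M[R]_(p, q);
  hi : 'M[R]_(p, q);
  lo_le_hi : forall i j, lo i j <= hi i j }.

Definition bset p q (al : box p q) : set 'M[R]_(p, q) :=
  [set A | forall i j, lo al i j <= A i j <= hi al i j].

Lemma span_subproof p q (A B : 'M[R]_(p, q)) i j :
  (\matrix_(i, j) Num.min (A i j) (B i j)) i j <=
  (\matrix_(i, j) Num.max (A i j) (B i j)) i j.
Proof. by rewrite !mxE ge_min le_max lexx. Qed.

(* The smallest box containing [A] and [B], i.e. [A, B] when A <= B. It makes
   the operations below total without carrying proofs that lo <= hi. *)
Definition bspan p q (A B : 'M[R]_(p, q)) : box p q := Box (span_subproof A B).

Definition bpoint p q (A : 'M[R]_(p, q)) : box p q := bspan A A.

Definition bcube p q (r : R) : box p q := bspan (const_mx (- r)) (const_mx r).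

Definition badd p q (al be : box p q) : box p q :=
  bspan (lo al + lo be) (hi al + hi be).

Definition bscale p q (t : R) (al : box p q) : box p q :=
  bspan (t *: lo al) (t *: hi al).

Definition imul_lo (a b c d : R) : R :=
  Num.min (Num.min (a * c) (a * d)) (Num.min (b * c) (b * d)).

Definition imul_hi (a b c d : R) : R :=
  Num.max (Num.max (a * c) (a * d)) (Num.max (b * c) (b * d)).

Definition bmul p q r (al : box p q) (be : box q r) : box p r :=
  bspan
   (\matrix_(i, k) \sum_j imul_lo (lo al i j) (hi al i j) (lo be j k) (hi be j k))
   (\matrix_(i, k) \sum_j imul_hi (lo al i j) (hi al i j) (lo be j k) (hi be j k)).

Definition boplus p q (al : box p q) (r : R) : box p q :=
  badd al (bcube p q r).

(* Entrywise integration of the bounds; [bspan] does not reorder them when they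
   are integrable. *)
Definition bint p q (s t : R) (g : R -> box p q) : box p q :=
  bspan
   (\matrix_(i, j) Rintegral lebesgue_measure `[s, t] (fun x => lo (g x) i j))
   (\matrix_(i, j) Rintegral lebesgue_measure `[s, t] (fun x => hi (g x) i j)).

(* The smallest box containing X; the whole space when X is unbounded. *)
Definition hull p q (X : set 'M[R]_(p, q)) : set 'M[R]_(p, q) :=
  \bigcap_(al in [set al : box p q | X `<=` bset al]) bset al.

Definition cube p q (B : {posnum rat}) : set 'M[R]_(p, q) :=
  bset (bcube p q (ratr B%:num)).

(* I[-B, B]^(p * q) *)
Record ibox (B : {posnum rat}) (p q : nat) := IBox {
  ibox_box :> box p q;
  ibox_sub : bset ibox_box `<=` cube B }.

Definition ble B p q (al be : ibox B p q) : Prop := bset be `<=` bset al.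

Definition bway_below B p q (al be : ibox B p q) : Prop :=
  way_below setT (@ble B p q) al be.

Definition rational_box B p q (al : ibox B p q) : Prop :=
  forall i j, exists l h : rat, lo al i j = ratr l /\ hi al i j = ratr h.

Definition bbot B p q : ibox B p q :=
  @IBox B p q (bcube p q (ratr B%:num)) (@subset_refl _ _).

Definition clamp (B x : R) : R := Num.max (- B) (Num.min B x).

Definition clamp_mx B p q (A : 'M[R]_(p, q)) : 'M[R]_(p, q) :=
  map_mx (clamp (ratr (B : {posnum rat})%:num)) A.

Lemma cubeE B p q (A : 'M[R]_(p, q)) :
  cube B A <-> forall i j, - ratr B%:num <= A i j <= ratr B%:num.
Proof.
have B0 : 0 < ratr B%:num :> R by rewrite ltr0q.
have BB : - ratr B%:num <= ratr B%:num :> R.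
  by apply: (@le_trans _ _ 0); rewrite ?oppr_le0 ltW.
by split=> H i j; move: (H i j); rewrite !mxE min_l// max_r.
Qed.

Lemma clamp_bound (B x : R) : 0 <= B -> - B <= clamp B x <= B.
Proof.
move=> B0; have BB : - B <= B by apply: (@le_trans _ _ 0); rewrite ?oppr_le0.
by rewrite /clamp le_max lexx /= ge_max BB ge_min lexx.
Qed.

Lemma le_clamp (B x y : R) : x <= y -> clamp B x <= clamp B y.
Proof.
by move=> xy; rewrite /clamp ge_max !le_max lexx /= le_min !ge_min lexx /= xy !orbT.
Qed.

Lemma clampP (B l h x : R) : (exists2 y, l <= y <= h & - B <= y <= B) ->
  (clamp B l <= x <= clamp B h) = (l <= x <= h) && (- B <= x <= B).
Proof.
move=> [y /andP[ly yh] /andP[By yB]]; rewrite /clamp.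
have lB : l <= B by exact: le_trans yB.
have Bh : - B <= h by exact: le_trans yh.
have BB : - B <= B by exact: le_trans yB.
have Bh' : - B <= Num.min B h by rewrite le_min BB.
rewrite (min_r lB) (max_r Bh') ge_max le_min.
by case: (- B <= x); case: (l <= x); case: (x <= h); case: (x <= B).
Qed.

Lemma bset_clamp B p q (al : box p q) (A : 'M[R]_(p, q)) :
  bset (bspan (clamp_mx B (lo al)) (clamp_mx B (hi al))) A <->
  forall i j, clamp (ratr B%:num) (lo al i j) <= A i j
              <= clamp (ratr B%:num) (hi al i j).
Proof.
split=> H i j; move: (H i j);
  by rewrite !mxE min_l ?max_r//; apply: le_clamp; exact: lo_le_hi.
Qed.

Lemma trunc_subproof B p q (al : box p q) :
  bset (bspan (clamp_mx B (lo al)) (clamp_mx B (hi al))) `<=` cube B.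
Proof.
move=> A /bset_clamp H; apply/cubeE => i j.
have B0 : 0 <= ratr B%:num :> R by rewrite ltW// ltr0q.
have /andP[l1 _] := clamp_bound (lo al i j) B0.
have /andP[_ h2] := clamp_bound (hi al i j) B0.
by have /andP[l h] := H i j; rewrite (le_trans l1 l) (le_trans h h2).
Qed.

(* The truncation X `&` [-B, B]^(p * q) of a box X (see [bset_trunc]). When
   this intersection is empty, which does happen for the operator [Phi] below,
   the value is the image of X under the nearest-point projection onto the
   cube; this keeps the truncation total, monotone and Scott continuous. *)
Definition trunc B p q (al : box p q) : ibox B p q :=
  IBox (@trunc_subproof B p q al).

Lemma bset_trunc B p q (al : box p q) :
  bset al `&` cube B !=set0 -> bset (trunc B al) = bset al `&` cube B.
Proof.
move=> [C [alC /cubeE BC]].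
have cP i j x : (clamp (ratr B%:num) (lo al i j) <= x
    <= clamp (ratr B%:num) (hi al i j)) =
    (lo al i j <= x <= hi al i j) && (- ratr B%:num <= x <= ratr B%:num).
  by apply: clampP; exists (C i j).
apply/seteqP; split=> [A /bset_clamp H|A [alA /cubeE BA]].
  by split; [|apply/cubeE] => i j; have := H i j; rewrite cP => /andP[].
by apply/bset_clamp => i j; rewrite cP alA BA.
Qed.

End Boxes.

Arguments box R p q : clear implicits.
Arguments ibox R B p q : clear implicits.
Arguments bbot {R B p q}.
Arguments ble {R B p q}.

Section V1.
Context {R : realType}.
Context (K M M1 : {posnum rat}) (n : nat).

Definition rel_open (O : set 'cV[R]_n) : Prop :=
  exists2 U, open U & O = U `&` cube K.

(* [h \in delta(O, b)] *)
Definition tie (h : 'cV[R]_n -> R) (O b : set 'cV[R]_n) : Prop :=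
  forall x y, O x -> O y ->
    exists2 c, b c & h x - h y = \sum_i c i 0 * (x i 0 - y i 0).

Definition Lder (h : 'cV[R]_n -> R) (x : 'cV[R]_n) : set 'cV[R]_n :=
  \bigcap_(b in [set b | (b = setT \/ exists al : box R n 1, b = bset al) /\
                         exists O, [/\ rel_open O, O x & tie h O b]]) b.

Definition Lder_mx (h : 'cV[R]_n -> 'cV[R]_n) (x : 'cV[R]_n) :
    set 'M[R]_n :=
  [set A | forall i, Lder (fun y => h y i 0) x (row i A)^T].

Definition Iext p q r s (g : 'M[R]_(p, q) -> set 'M[R]_(r, s))
    (al : box R p q) : set 'M[R]_(r, s) :=
  hull (\bigcup_(x in bset al) g x).

Definition consistent (u : ibox R K n 1 -> ibox R M n 1)
    (u' : ibox R K n 1 -> ibox R M1 n n) : Prop :=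
  exists h : 'cV[R]_n -> 'cV[R]_n,
    [/\ forall x, cube K x -> cube M (h x),
        forall al : ibox R K n 1, Iext (fun x => [set h x]) al `<=` bset (u al)
      & forall al : ibox R K n 1, Iext (Lder_mx h) al `<=` bset (u' al)].

Record V1 := MkV1 {
  fld : ibox R K n 1 -> ibox R M n 1;
  dfld : ibox R K n 1 -> ibox R M1 n n;
  fld_cont : scott_continuous ble ble fld;
  dfld_cont : scott_continuous ble ble dfld;
  fld_consistent : consistent fld dfld }.

(* [f] is the supremum of the [b l] chi_(way-above set of [c l]), [l < N], all
   boxes being rational. *)
Definition V1_rep B p q (N : nat) (c : nat -> ibox R K n 1)
    (b : nat -> ibox R B p q) (f : ibox R K n 1 -> ibox R B p q) : Prop :=
  (forall l, (l < N)%N -> rational_box (c l) /\ rational_box (b l)) /\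
  is_step ble bbot N (fun l => [set al | bway_below (c l) al]) b f.

Definition V1_step B p q (f : ibox R K n 1 -> ibox R B p q) : Prop :=
  exists N c b, V1_rep N c b f.

End V1.

Arguments V1 R K M M1 n : clear implicits.

Definition computable_box {R : realType} B p q
    (al : nat -> nat -> ibox R B p q) : Prop :=
  forall i j, exists l h : nat -> nat -> rat,
    [/\ computable_rat l, computable_rat h &
      forall k t, lo (al k t) i j = ratr (l k t) /\
                  hi (al k t) i j = ratr (h k t)].

(* Effectiveness of an enumeration: the finite rational data defining the
   [k]-th element are computable from [k]. *)
Definition V1_enum {R : realType} K M M1 n (v : nat -> V1 R K M M1 n) : Prop :=
  [/\ fld (v 0%N) = (fun=> bbot) /\ dfld (v 0%N) = (fun=> bbot),
      (forall w : V1 R K M M1 n, V1_step (fld w) -> V1_step (dfld w) ->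
        exists k, fld (v k) = fld w /\ dfld (v k) = dfld w),
      exists N c b, [/\ recursive1 N, computable_box c, computable_box b &
        forall k, V1_rep (N k) (c k) (b k) (fld (v k))]
    & exists N c b, [/\ recursive1 N, computable_box c, computable_box b &
        forall k, V1_rep (N k) (c k) (b k) (dfld (v k))]].

Section WD.
Context {R : realType}.
Context (K : {posnum rat}) (n : nat) (a : rat).

Definition seg : Type := {x : R | x \in `[0, ratr a]}.

(* (p, r] `&` [0, a] *)
Definition seg_oc (p r : rat) : set seg :=
  [set x | ratr p < val x <= ratr r].

Definition seg_open (U : set seg) : Prop :=
  forall x, U x -> exists p r, seg_oc p r x /\ seg_oc p r `<=` U.

Local Notation D := (seg -> ibox R K n 1).

Definition DQ : set D :=
  [set f | forall U, scott_open ble U -> seg_open (f @^-1` U)].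

Definition fle : D -> D -> Prop := pointwise ble.

Definition BD_rep (N : nat) (p r : nat -> rat) (b : nat -> ibox R K n 1)
    (th : D) : Prop :=
  (forall l, (l < N)%N -> rational_box (b l)) /\
  is_step ble bbot N (fun l => seg_oc (p l) (r l)) b th.

Definition BD : set D :=
  [set th | DQ th /\ exists N p r b, BD_rep N p r b th].

(* The relation [<|_D] on [BD]. *)
Definition tri0 (th th' : D) : Prop :=
  [/\ BD th, BD th' & exists N p r b, BD_rep N p r b th /\
    forall l, (l < N)%N -> forall x, seg_oc (p l) (r l) x ->
      bway_below (b l) (th' x)].

Definition tri (f g : D) : Prop :=
  exists th1 th2, [/\ fle f th1, tri0 th1 th2 & fle th2 g].

(* The carrier of W_D: the rounded ideals of [(BD, tri0)]. *)
Definition WD : set (set D) :=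
  [set phi | [/\ phi !=set0, phi `<=` BD,
    forall x y, tri0 x y -> phi y -> phi x
  & forall A, finite_set A -> A `<=` phi ->
      exists2 z, phi z & forall x, A x -> tri0 x z]].

(* f_* *)
Definition lowstar (f : D) : set D := [set b | BD b /\ tri b f].

(* phi^* *)
Definition upstar (phi : set D) : D :=
  xget (T := {classic D}) (fun=> bbot) [set f : D | is_lub DQ fle phi f].

(* i_D *)
Definition iD (b : D) : set D := [set x | tri0 x b].

Definition BD_enum (b : nat -> D) : Prop :=
  [/\ b 0%N = (fun=> bbot),
      (forall i, BD (b i)),
      (forall th, BD th -> exists i, b i = th)
    & exists N p r c, [/\ recursive1 N, computable_rat p, computable_rat r,
        computable_box c & forall i, BD_rep (N i) (p i) (r i) (c i) (b i)]].

Definition is_partition (Q : seq rat) : Prop :=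
  [/\ (1 < size Q)%N, head 0 Q = 0, last 0 Q = a & sorted <%R Q].

End WD.

Arguments seg R a : clear implicits.
Arguments DQ R K n a : clear implicits.
Arguments BD R K n a : clear implicits.
Arguments WD R K n a : clear implicits.

Section Operators.
Context {R : realType}.
Context (K M M1 : {posnum rat}) (n : nat) (a : rat).

(* For a partition [Q] and [x] in [0, a], the [find] is 0 iff [x = 0], and is
   [j.+1] iff q_j < x <= q_(j+1). As [Q`_j] is in [0, a], the default value [x]
   of [insubd] is never used. *)
Definition Phi (w : V1 R K M M1 n) (Q : seq rat)
    (phi : seg R a -> ibox R K n 1) : seg R a -> ibox R K n 1 :=
  fun x =>
    if find (fun q => val x <= ratr q) Q is j.+1 then
      let qj : R := ratr Q`_j in
      let Delta : R := ratr (Q`_j.+1 - Q`_j) in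
      let al := phi (insubd x qj) in
      let be := trunc K (boplus al (ratr M%:num * Delta)) in
      trunc K (badd al (bint qj (val x) (fun t =>
        badd (fld w al) (bscale (t - qj) (bmul (dfld w be) (fld w be))))))
    else trunc K (bpoint 0).

Definition F (Q : seq rat) (w : V1 R K M M1 n)
    (phi : set (seg R a -> ibox R K n 1)) : set (seg R a -> ibox R K n 1) :=
  lowstar (Phi w Q (upstar phi)).

End Operators.

(* Main.v *)
(* In W_D, i_D(b) is way below an ideal iff b belongs to it, and i_D(b)^* = b;
   so the set to enumerate is that of the triples with b_i in
   Phi_(u_k, u_k')(Q)(b_j)_*. A step function is in g_* iff, for some e > 0, its
   steps still approximate g after all bounds not on the boundary of the cube
   are moved inwards by e. For fixed e this is decidable when g = Phi(...): on
   each piece of Q the bounds of g are truncations of quadratic polynomials in x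
   whose coefficients are rational and computed from (i, j, k), and the
   nonnegativity of a quadratic polynomial on an interval is a quantifier-free
   condition on its coefficients. Searching for e = 1 / (m + 1) is then an
   unbounded minimization. *)
Require Import Defs.
From HB Require Import structures.
From mathcomp Require Import all_boot all_order all_algebra.
From mathcomp Require Import all_classical all_reals all_analysis.
From mathcomp Require Import ring lra.
Set Implicit Arguments.
Unset Strict Implicit.
Unset Printing Implicit Defensive.
Import Order.TTheory GRing.Theory Num.Theory.
Import numFieldNormedType.Exports.
Local Open Scope classical_set_scope.
Local Open Scope ring_scope.

(** * Recursive functions *)

(* Way-below between boxes is a strict inequality at each entry, except that a bound on the boundary
   of the cube imposes nothing: hence such bounds are never moved. A margin uniform in x exists
   because step functions have finitely many bounds. It is read off from the step functions that
   [tri] interpolates between b_i and g, never from g, which may take infinitely many values. A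
   fixed margin e also replaces strict inequalities by weak ones, and these pass to the missing left
   end of (p, r] by continuity. Phi consults b_j at the nodes of Q only; so finitely many boxes
   enter, all rational, and u_k, u_k' are evaluated at rational boxes. As Q is fixed, its pieces
   give a conjunction unrolled into the code, whereas the number of steps of b_i depends on i and
   calls for a bounded quantifier inside the recursion. The quantities are real numbers, but each is
   carried by recursive functions giving its numerator and denominator, so that order and equality
   are decided by cross-multiplication. *)
Scheme reval_mind := Induction for reval Sort Prop
with revals_mind := Induction for revals Sort Prop.

Lemma reval_det c s y : reval c s y -> forall z, reval c s z -> y = z.
Proof.
apply: (@reval_mind (fun c s y _ => forall z, reval c s z -> y = z)
  (fun cs s ys _ => forall zs, revals cs s zs -> ys = zs)).
- by move=> s' z h; inversion h.
- by move=> x s' z h; inversion h.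
- by move=> i s' si z h; inversion h.
- move=> f gs s' ys y' gsP IHgs fP IHf z h; inversion h; subst.
  by apply: IHf; erewrite IHgs; eassumption.
- by move=> f g s' y' fP IHf z h; inversion h; subst; exact: IHf.
- move=> f g m s' z y' fP IHf gP IHg w h; inversion h; subst.
  by apply: IHg; erewrite IHf; eassumption.
- move=> f s' m z fP IHf fm IHm w h; inversion h as [| | | | | |? ? ? z' z'P wP]; subst.
  (* Of two candidate minima, the smaller one gets a zero from its own derivation and a successor
     from the other. *)
  case: (ltngtP m w) => // mw.
    by have := IHm _ (z'P _ mw).
  by have := IHf _ mw _ wP.
- by move=> s' zs h; inversion h.
- move=> g gs s' y' ys gP IHg gsP IHgs zs h; inversion h; subst.
  by congr cons; [apply: IHg|apply: IHgs].
Qed.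

(** Packing the arguments in a list lets one statement serve every arity. Only lists of size [m]
    count, since a code has no arity of its own. *)
Definition total_rec (m : nat) (f : seq nat -> nat) : Prop :=
  exists c, forall s, size s = m -> reval c s (f s).

(* Substitutions of [m']-tuples of terms in [m] variables. *)
Definition total_env (m m' : nat) (e : seq nat -> seq nat) : Prop :=
  exists cs, forall s, size s = m -> size (e s) = m' /\ revals cs s (e s).

Section TotalRec.
Implicit Types (m : nat) (f g h : seq nat -> nat).

Lemma total_rec_ext m f g :
  (forall s, size s = m -> f s = g s) -> total_rec m f -> total_rec m g.
Proof. by move=> fg [c cP]; exists c => s sm; rewrite -fg//; exact: cP. Qed.

Lemma total_rec_subst m m' f e :
  total_rec m' f -> total_env m m' e -> total_rec m (f \o e).
Proof.
move=> [c cP] [cs csP]; exists (RComp c cs) => s sm.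
by have [? ?] := csP s sm; apply: reval_comp; [eassumption|exact: cP].
Qed.

Lemma total_env_nil m : total_env m 0 (fun=> [::]).
Proof. by exists [::] => s _; split=> //; constructor. Qed.

Lemma total_env_cons m m' f e : total_rec m f -> total_env m m' e ->
  total_env m m'.+1 (fun s => f s :: e s).
Proof.
move=> [c cP] [cs csP]; exists (c :: cs) => s sm; have [? ?] := csP s sm.
by split; [rewrite /=; congr S|constructor=> //; exact: cP].
Qed.

Lemma revals_proj (r : seq nat) s : (forall i, i \in r -> (i < size s)%N) ->
  revals [seq RProj i | i <- r] s [seq nth 0%N s i | i <- r].
Proof.
elim: r => [|i r IH] H /=; first by constructor.
constructor; first by constructor; apply: H; rewrite mem_head.
by apply: IH => j jr; apply: H; rewrite in_cons jr orbT.
Qed.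

Lemma total_env_drop k m : total_env (k + m) m (drop k).
Proof.
exists [seq RProj i | i <- iota k m] => s sm.
have sd : size (drop k s) = m by rewrite size_drop sm addKn.
split=> //.
have -> : drop k s = [seq nth 0%N s i | i <- iota k m].
  apply: (@eq_from_nth _ 0%N) => [|i]; first by rewrite size_map size_iota.
  rewrite sd => im.
  by rewrite nth_drop (nth_map 0%N) ?size_iota// nth_iota.
apply: revals_proj => i; rewrite mem_iota sm => /andP[_ ?]//.
Qed.

Lemma total_env_id m : total_env m m id.
Proof.
by have [cs H] := total_env_drop 0 m; exists cs => s /H; rewrite drop0.
Qed.

Lemma total_env_behead m : total_env m.+1 m behead.
Proof.
by have [cs H] := total_env_drop 1 m; exists cs => s /H; rewrite drop1.
Qed.

Lemma total_rec_nth m i : (i < m)%N -> total_rec m (fun s => nth 0%N s i).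
Proof. by move=> im; exists (RProj i) => s sm; constructor; rewrite sm. Qed.

Lemma total_rec_succ m f : total_rec m f -> total_rec m (fun s => (f s).+1).
Proof.
move=> [c cP]; exists (RComp RSucc [:: c]) => s sm.
apply: (@reval_comp _ _ _ [:: f s]); last by constructor.
by constructor; [exact: cP|constructor].
Qed.

Lemma total_rec_cst m k : total_rec m (fun=> k).
Proof.
by elim: k => [|k]; [exists RZero => s _; constructor|exact: total_rec_succ].
Qed.

(** The number of iterations is itself a term [h]: recursion runs on a fresh first argument, for
    which [h s] is then substituted. The arguments of [g] (counter, previous value, parameters) come
    in the order of [reval_precS]. *)
Lemma total_rec_nat_rect m f g h :
  total_rec m f -> total_rec m.+2 g -> total_rec m h ->
  total_rec m (fun s => nat_rect (fun=> nat) (f s)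
                          (fun l z => g [:: l, z & s]) (h s)).
Proof.
move=> [cf cfP] [cg cgP] hP.
pose H (s : seq nat) : nat :=
  nat_rect (fun=> nat) (f (behead s))
    (fun l z => g [:: l, z & behead s]) (head 0%N s).
have HP : total_rec m.+1 H.
  exists (RPrec cf cg) => -[//|k s] [sm]; rewrite /H /=.
  elim: k => [|k IH]; first by constructor; exact: cfP.
  by apply: reval_precS; [exact: IH|apply: cgP => /=; rewrite sm].
exact: total_rec_subst HP (total_env_cons hP (total_env_id m)).
Qed.

Lemma total_rec1 m (F : nat -> nat) f :
  recursive1 F -> total_rec m f -> total_rec m (fun s => F (f s)).
Proof.
move=> [c cP] fP; pose F' s := F (nth 0%N s 0).
have F'P : total_rec 1 F' by exists c => -[|i []]//= _; exact: cP.
exact: total_rec_subst F'P (total_env_cons fP (total_env_nil m)).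
Qed.

Lemma total_rec2 m (F : nat -> nat -> nat) f g :
  recursive2 F -> total_rec m f -> total_rec m g ->
  total_rec m (fun s => F (f s) (g s)).
Proof.
move=> [c cP] fP gP; pose F' s := F (nth 0%N s 0) (nth 0%N s 1).
have F'P : total_rec 2 F' by exists c => -[|i [|j []]]//= _; exact: cP.
exact: total_rec_subst F'P
  (total_env_cons fP (total_env_cons gP (total_env_nil m))).
Qed.

Lemma total_rec_weak k m f : total_rec m f -> total_rec (k + m) (f \o drop k).
Proof. by move=> fP; exact: total_rec_subst fP (total_env_drop k m). Qed.

Lemma total_rec_add m f g :
  total_rec m f -> total_rec m g -> total_rec m (fun s => (f s + g s)%N).
Proof.
move=> fP gP; apply: total_rec_ext (total_rec_nat_rect fP
  (total_rec_succ (@total_rec_nth m.+2 1 isT)) gP) => s _ /=.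
by elim: (g s) => [|k /= ->]; rewrite ?addn0 ?addnS.
Qed.

Lemma total_rec_mul m f g :
  total_rec m f -> total_rec m g -> total_rec m (fun s => (f s * g s)%N).
Proof.
move=> fP gP; apply: total_rec_ext (total_rec_nat_rect (total_rec_cst m 0)
  (total_rec_add (@total_rec_nth m.+2 1 isT) (total_rec_weak 2 fP)) gP) => s _.
by elim: (g s) => [|k /= ->]; rewrite ?muln0// mulnS addnC drop0.
Qed.

Lemma total_rec_pred m f : total_rec m f -> total_rec m (fun s => (f s).-1).
Proof.
move=> fP; apply: total_rec_ext (total_rec_nat_rect (total_rec_cst m 0)
  (@total_rec_nth m.+2 0 isT) fP) => s _.
by case: (f s).
Qed.

Lemma total_rec_sub m f g :
  total_rec m f -> total_rec m g -> total_rec m (fun s => (f s - g s)%N).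
Proof.
move=> fP gP; apply: total_rec_ext (total_rec_nat_rect fP
  (total_rec_pred (@total_rec_nth m.+2 1 isT)) gP) => s _ /=.
by elim: (g s) => [|k /= ->]; rewrite ?subn0 ?subnS.
Qed.

End TotalRec.

(** * Decidable predicates and unbounded search *)

Definition decidable_rec (m : nat) (P : seq nat -> bool) : Prop :=
  total_rec m (fun s => nat_of_bool (P s)).

Section DecidableRec.
Implicit Types (m : nat) (f g : seq nat -> nat) (P S : seq nat -> bool).

Lemma decidable_rec_ext m P S :
  (forall s, size s = m -> P s = S s) -> decidable_rec m P -> decidable_rec m S.
Proof. by move=> PS; apply: total_rec_ext => s /PS ->. Qed.

Lemma decidable_rec_subst m m' P e :
  decidable_rec m' P -> total_env m m' e -> decidable_rec m (P \o e).
Proof. exact: total_rec_subst. Qed.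

Lemma decidable_rec_cst m b : decidable_rec m (fun=> b).
Proof. exact: total_rec_cst. Qed.

Lemma decidable_rec_neg m P :
  decidable_rec m P -> decidable_rec m (fun s => ~~ P s).
Proof.
move=> PP; apply: total_rec_ext (total_rec_sub (total_rec_cst m 1) PP) => s _.
by case: (P s).
Qed.

Lemma decidable_rec_and m P S : decidable_rec m P -> decidable_rec m S ->
  decidable_rec m (fun s => P s && S s).
Proof.
move=> PP SP; apply: total_rec_ext (total_rec_mul PP SP) => s _.
by rewrite mulnb.
Qed.

Lemma decidable_rec_or m P S : decidable_rec m P -> decidable_rec m S ->
  decidable_rec m (fun s => P s || S s).
Proof.
move=> PP SP; apply: decidable_rec_ext (decidable_rec_neg
  (decidable_rec_and (decidable_rec_neg PP) (decidable_rec_neg SP))) => s _.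
by rewrite -negb_or negbK.
Qed.

Lemma decidable_rec_imp m P S : decidable_rec m P -> decidable_rec m S ->
  decidable_rec m (fun s => P s ==> S s).
Proof.
move=> PP SP; apply: decidable_rec_ext
  (decidable_rec_or (decidable_rec_neg PP) SP) => s _.
by rewrite implybE.
Qed.

Lemma decidable_rec_leq m f g : total_rec m f -> total_rec m g ->
  decidable_rec m (fun s => (f s <= g s)%N).
Proof.
move=> fP gP; apply: total_rec_ext (total_rec_sub (total_rec_cst m 1)
  (total_rec_sub fP gP)) => s _.
by rewrite /leq; case: (f s - g s)%N.
Qed.

(** The bound varies with the arguments, so the truth values are multiplied by primitive
    recursion. *)
Lemma decidable_rec_all m P f : decidable_rec m.+1 P -> total_rec m f ->
  decidable_rec m (fun s => [forall l : 'I_(f s), P (val l :: s)]).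
Proof.
move=> PP fP.
(* Removes the accumulated product, which sits between the counter and the parameters. *)
pose e s := nth 0%N s 0 :: drop 2 s.
have eP : total_env m.+2 m.+1 e.
  exact: total_env_cons (@total_rec_nth m.+2 0 isT) (total_env_drop 2 m).
apply: total_rec_ext (total_rec_nat_rect (total_rec_cst m 1)
  (total_rec_mul (@total_rec_nth m.+2 1 isT)
     (decidable_rec_subst PP eP)) fP) => s _ /=.
elim: (f s) => [|k /= ->].
  by case: forallP => // -[] [].
rewrite /e /= drop0 mulnb; congr nat_of_bool.
apply/andP/forallP => [[/forallP H Hk] l|H].
  have [lk|kl] := ltnP l k; first exact: (H (Ordinal lk)).
  by have -> : val l = k; [apply/eqP; rewrite eqn_leq kl -ltnS ltn_ord|].
split; last exact: (H ord_max).
by apply/forallP => l; exact: (H (widen_ord (leqnSn k) l)).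
Qed.

Lemma total_rec_if m P f g :
  decidable_rec m P -> total_rec m f -> total_rec m g ->
  total_rec m (fun s => if P s then f s else g s).
Proof.
move=> PP fP gP; apply: total_rec_ext (total_rec_add (total_rec_mul PP fP)
  (total_rec_mul (decidable_rec_neg PP) gP)) => s _.
by case: (P s); rewrite ?mul1n ?mul0n ?addn0.
Qed.

Lemma decidable_rec_odd m f :
  total_rec m f -> decidable_rec m (fun s => odd (f s)).
Proof.
move=> fP; apply: total_rec_ext (total_rec_nat_rect (total_rec_cst m 0)
  (total_rec_sub (total_rec_cst _ 1) (@total_rec_nth m.+2 1 isT)) fP) => s _ /=.
by elim: (f s) => [//|k /= ->]; case: (odd k).
Qed.

(** The index type is fixed in advance, so the conjunction is unrolled into the code. *)
Lemma decidable_rec_forall (I : finType) m (P : I -> seq nat -> bool) :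
  (forall i, decidable_rec m (P i)) ->
  decidable_rec m (fun s => [forall i, P i s]).
Proof.
move=> PP.
have H (r : seq I) : decidable_rec m (fun s => all (P^~ s) r).
  by elim: r => [|i r IH] /=; [exact: decidable_rec_cst|exact: decidable_rec_and].
apply: decidable_rec_ext (H (enum I)) => s _.
apply/allP/forallP => [Q i|Q i _]; last exact: Q.
by apply: Q; rewrite mem_enum.
Qed.

End DecidableRec.

(** [RMin] looks for a zero, so the code searched is that of the negation, which is 0 exactly where
    [P] holds. Conversely, by determinism the zero found is the value of the total code. *)
Lemma re3_exists (P : seq nat -> bool) : decidable_rec 4 P ->
  re3 (fun i j k => exists m, P [:: m; i; j; k]).
Proof.
move=> /decidable_rec_neg[c cP]; exists (RMin c) => i j k; split=> [H|[y yP]].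
  case: (ex_minnP H) => m Pm m_min; exists m.
  (* Before the least witness the negation has value 1, the successor of this constant 0. *)
  apply: (@reval_min _ _ _ (fun=> 0%N)) => [l lm|].
    have := cP [:: l; i; j; k] erefl.
    by case: (boolP (P _)) => // /m_min; rewrite leqNgt lm.
  by have := cP [:: m; i; j; k] erefl; rewrite Pm.
inversion yP; subst; exists y.
by have := reval_det H1 (cP [:: y; i; j; k] erefl); case: (P _).
Qed.

(* [big_ord_recr] needs a neutral index. *)
Lemma bigmax_ord_recr {d} {T : orderType d} k (F : nat -> T) y :
  \big[Order.max/y]_(l < k.+1) F l =
  Order.max (\big[Order.max/y]_(l < k) F l) (F k).
Proof.
apply/le_anti/andP; split.
  apply: bigmax_le => [|l _]; first by rewrite le_max bigmax_ge_id.
  have [lk|kl] := ltnP l k; rewrite le_max; apply/orP; [left|right].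
    exact: (le_bigmax y (fun i : 'I_k => F i) (Ordinal lk)).
  by rewrite (_ : val l = k)//; apply/eqP; rewrite eqn_leq kl -ltnS ltn_ord.
rewrite ge_max; apply/andP; split; last first.
  exact: (le_bigmax y (fun i : 'I_k.+1 => F i) ord_max).
apply: bigmax_le => [|l _]; first exact: bigmax_ge_id.
exact: (le_bigmax y (fun i : 'I_k.+1 => F i) (widen_ord (leqnSn k) l)).
Qed.

(** A numerator that is a difference of naturals avoids case distinctions on signs, and a
    denominator stored as its predecessor is never zero. Fractions need not be reduced. *)
Definition rational_rec {R : realType} (m : nat) (x : seq nat -> R) : Prop :=
  exists p q d, [/\ total_rec m p, total_rec m q, total_rec m d &
    forall s, size s = m -> x s = ((p s)%:R - (q s)%:R) / (d s).+1%:R].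

Section RationalRec.
Context {R : realType}.
Implicit Types (m : nat) (x y : seq nat -> R).

Lemma rational_rec_ext m x y :
  (forall s, size s = m -> x s = y s) -> rational_rec m x -> rational_rec m y.
Proof.
move=> xy [p [q [d [pP qP dP H]]]]; exists p, q, d; split=> // s sm.
by rewrite -xy// H.
Qed.

Lemma rational_rec_subst m m' x e :
  rational_rec m' x -> total_env m m' e -> rational_rec m (x \o e).
Proof.
move=> [p [q [d [pP qP dP H]]]] eP.
exists (p \o e), (q \o e), (d \o e); split; try exact: total_rec_subst eP.
by move=> s sm /=; apply: H; case: eP => cs /(_ s sm)[].
Qed.

Lemma rational_rec_opp m x :
  rational_rec m x -> rational_rec m (fun s => - x s).
Proof.
move=> [p [q [d [pP qP dP H]]]]; exists q, p, d; split=> // s sm.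
by rewrite H// -mulNr opprB.
Qed.

Let succ_neq0 k : 1 + k%:R != 0 :> R. Proof. by rewrite nat1r pnatr_eq0. Qed.

Lemma rational_rec_add m x y : rational_rec m x -> rational_rec m y ->
  rational_rec m (fun s => x s + y s).
Proof.
move=> [p [q [d [pP qP dP H]]]] [p' [q' [d' [pP' qP' dP' H']]]].
have DP := total_rec_succ dP; have DP' := total_rec_succ dP'.
exists (fun s => p s * (d' s).+1 + p' s * (d s).+1)%N,
  (fun s => q s * (d' s).+1 + q' s * (d s).+1)%N,
  (fun s => ((d s).+1 * (d' s).+1).-1)%N; split.
- by apply: total_rec_add; exact: total_rec_mul.
- by apply: total_rec_add; exact: total_rec_mul.
- by apply: total_rec_pred; exact: total_rec_mul.
move=> s sm; rewrite H// H'// prednK ?muln_gt0// !natrD !natrM.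
by field; rewrite !succ_neq0.
Qed.

Lemma rational_rec_mul m x y : rational_rec m x -> rational_rec m y ->
  rational_rec m (fun s => x s * y s).
Proof.
move=> [p [q [d [pP qP dP H]]]] [p' [q' [d' [pP' qP' dP' H']]]].
have DP := total_rec_succ dP; have DP' := total_rec_succ dP'.
exists (fun s => p s * p' s + q s * q' s)%N,
  (fun s => p s * q' s + q s * p' s)%N,
  (fun s => ((d s).+1 * (d' s).+1).-1)%N; split.
- by apply: total_rec_add; exact: total_rec_mul.
- by apply: total_rec_add; exact: total_rec_mul.
- by apply: total_rec_pred; exact: total_rec_mul.
move=> s sm; rewrite H// H'// prednK ?muln_gt0// !natrD !natrM.
by field; rewrite !succ_neq0.
Qed.

Lemma rational_rec_sub m x y : rational_rec m x -> rational_rec m y ->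
  rational_rec m (fun s => x s - y s).
Proof.
by move=> xP yP; apply: rational_rec_add => //; exact: rational_rec_opp.
Qed.

(** After cross-multiplication the subtracted terms change sides, which leaves an inequality between
    naturals. *)
Lemma decidable_rec_ler m x y : rational_rec m x -> rational_rec m y ->
  decidable_rec m (fun s => x s <= y s).
Proof.
move=> [p [q [d [pP qP dP H]]]] [p' [q' [d' [pP' qP' dP' H']]]].
have DP := total_rec_succ dP; have DP' := total_rec_succ dP'.
apply: decidable_rec_ext (decidable_rec_leq
  (total_rec_add (total_rec_mul pP DP') (total_rec_mul qP' DP))
  (total_rec_add (total_rec_mul pP' DP) (total_rec_mul qP DP'))) => s sm.
rewrite H// H'// ler_pdivrMr ?ltr0n// mulrAC ler_pdivlMr ?ltr0n//.
by rewrite -(ler_nat R) !natrD !natrM; apply/idP/idP; lra.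
Qed.

Lemma decidable_rec_ltr m x y : rational_rec m x -> rational_rec m y ->
  decidable_rec m (fun s => x s < y s).
Proof.
move=> xP yP; apply: decidable_rec_ext
  (decidable_rec_neg (decidable_rec_ler yP xP)) => s _.
by rewrite ltNge.
Qed.

Lemma decidable_rec_eqr m x y : rational_rec m x -> rational_rec m y ->
  decidable_rec m (fun s => x s == y s).
Proof.
move=> xP yP; apply: decidable_rec_ext (decidable_rec_and
  (decidable_rec_ler xP yP) (decidable_rec_ler yP xP)) => s _.
by rewrite eq_le.
Qed.

Lemma rational_rec_if m P x y :
  decidable_rec m P -> rational_rec m x -> rational_rec m y ->
  rational_rec m (fun s => if P s then x s else y s).
Proof.
move=> PP [p [q [d [pP qP dP H]]]] [p' [q' [d' [pP' qP' dP' H']]]].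
exists (fun s => if P s then p s else p' s), (fun s => if P s then q s else q' s),
  (fun s => if P s then d s else d' s); split; try exact: total_rec_if.
by move=> s sm; rewrite H// H'//; case: ifP.
Qed.

Lemma rational_rec_min m x y : rational_rec m x -> rational_rec m y ->
  rational_rec m (fun s => Num.min (x s) (y s)).
Proof.
move=> xP yP; exact: rational_rec_if (decidable_rec_ltr xP yP) xP yP.
Qed.

Lemma rational_rec_max m x y : rational_rec m x -> rational_rec m y ->
  rational_rec m (fun s => Num.max (x s) (y s)).
Proof.
move=> xP yP; exact: rational_rec_if (decidable_rec_ltr xP yP) yP xP.
Qed.

Lemma rational_rec_natr m f :
  total_rec m f -> rational_rec m (fun s => (f s)%:R : R).
Proof.
move=> fP; exists f, (fun=> 0%N), (fun=> 0%N); split=> //.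
1,2: exact: total_rec_cst.
by move=> s _; rewrite subr0 divr1.
Qed.

Lemma rational_rec_inv_succ m f :
  total_rec m f -> rational_rec m (fun s => (f s).+1%:R^-1 : R).
Proof.
move=> fP; exists (fun=> 1%N), (fun=> 0%N), f; split=> //.
1,2: exact: total_rec_cst.
by move=> s _; rewrite subr0 div1r.
Qed.

Lemma rational_rec_computable m (x : nat -> nat -> rat) f g :
  computable_rat x -> total_rec m f -> total_rec m g ->
  rational_rec m (fun s => ratr (x (f s) (g s)) : R).
Proof.
move=> [u [p [d [uP pP dP H]]]] fP gP.
have sP := decidable_rec_odd (total_rec2 uP fP gP).
apply: (@rational_rec_ext _ (fun s => (if odd (u (f s) (g s)) then
    - (p (f s) (g s))%:R : R else (p (f s) (g s))%:R) * (d (f s) (g s)).+1%:R^-1)).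
  move=> s _; rewrite H -signr_odd fmorph_div rmorphM rmorph_sign !rmorph_nat.
  by case: odd; rewrite ?mulN1r ?mul1r.
apply: rational_rec_mul; last by apply: rational_rec_inv_succ; exact: total_rec2.
by apply: rational_rec_if => //; try apply: rational_rec_opp;
  apply: rational_rec_natr; exact: total_rec2.
Qed.

Lemma rational_rec_ratr m (q : rat) : rational_rec m (fun=> ratr q : R).
Proof.
rewrite (_ : q = (numq q)%:~R / (denq q)%:~R); last by rewrite divq_num_den.
have -> : denq q = (`|denq q|.-1.+1)%:Z.
  by rewrite prednK ?absz_gt0 ?denq_neq0// absz_denq.
apply: (@rational_rec_ext _ (fun=> ratr (numq q)%:~R * `|denq q|.-1.+1%:R^-1)).
  by move=> s _; rewrite rmorphM/= fmorphV/= -pmulrn ratr_nat.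
apply: rational_rec_mul; last first.
  by apply: rational_rec_inv_succ; exact: total_rec_cst.
have H (p : nat) : rational_rec m (fun=> ratr p%:R : R).
  rewrite ratr_nat.
  by apply: rational_rec_natr; exact: total_rec_cst.
case: (numq q) => p; first exact: H.
by rewrite NegzE mulrNz rmorphN; exact: (rational_rec_opp (H p.+1)).
Qed.

Lemma rational_rec_sum (I : Type) (r : seq I) m (x : I -> seq nat -> R) :
  (forall i, rational_rec m (x i)) -> rational_rec m (fun s => \sum_(i <- r) x i s).
Proof.
move=> xP; elim: r => [|i r IH].
  apply: (rational_rec_ext _ (rational_rec_ratr m 0)) => s _.
  by rewrite big_nil rmorph0.
by apply: (rational_rec_ext _ (rational_rec_add (xP i) IH)) => s _; rewrite big_cons.
Qed.

(* Pairs of naturals are avoided in the recursion by carrying the index of a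
   maximal term instead of its value. *)
Lemma rational_rec_bigmax m x y f :
  rational_rec m.+1 x -> rational_rec m y -> total_rec m f ->
  rational_rec m (fun s => \big[Num.max/y s]_(l < f s) x (val l :: s)).
Proof.
move=> xP yP fP.
(* Here [z] is the index of a maximal term so far and [l] the new index. *)
pose g (t : seq nat) : nat :=
  let l := nth 0%N t 0 in let z := nth 0%N t 1 in
  if x (z :: drop 2 t) <= x (l :: drop 2 t) then l else z.
have gP : total_rec m.+2 g.
  have eP i : (i < 2)%N ->
      total_env m.+2 m.+1 (fun t => nth 0%N t i :: drop 2 t).
    move=> i2; apply: total_env_cons (total_env_drop 2 m).
    by apply: total_rec_nth; rewrite (leq_trans i2).
  apply: total_rec_if; [|exact: total_rec_nth|exact: total_rec_nth].
  apply: (@decidable_rec_ler m.+2 (x \o _) (x \o _));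
    apply: rational_rec_subst xP _; exact: eP.
have iP := total_rec_nat_rect (total_rec_cst m 0) gP fP.
have /rational_rec_subst /(_ (total_env_cons iP (total_env_id m))) tP := xP.
(* The recursion starts from index 0, which is a term of the maximum only when [f s] is positive;
   otherwise the result is [y s]. *)
apply: rational_rec_ext (rational_rec_if
  (decidable_rec_leq (total_rec_succ (total_rec_cst m 0)) fP)
  (rational_rec_max yP tP) yP) => s sm.
rewrite /=; case: (f s) => [|k] /=; first by rewrite big_ord0.
elim: k => [|k IH].
  by rewrite big_ord_recl big_ord0 /g /= drop0 if_same maxC.
rewrite (bigmax_ord_recr _ (fun l => x (l :: s))) -IH.
set i := nat_rect _ _ _ _; rewrite {1}/g /= -/i drop0.
rewrite -maxA; congr Num.max.
by case: leP => xi; rewrite ?(max_r xi) ?max_l// ltW.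
Qed.

Lemma rational_rec_bigmin m x y f :
  rational_rec m.+1 x -> rational_rec m y -> total_rec m f ->
  rational_rec m (fun s => \big[Num.min/y s]_(l < f s) x (val l :: s)).
Proof.
move=> xP yP fP; apply: rational_rec_ext (rational_rec_opp (rational_rec_bigmax
  (rational_rec_opp xP) (rational_rec_opp yP) fP)) => s _.
have oppM : {morph -%R : u v / Num.max u v >-> Num.min u v :> R}.
  exact: oppr_max.
rewrite (big_morph -%R oppM (opprK _)).
by under eq_bigr do rewrite opprK.
Qed.

End RationalRec.

(** * Boxes *)

(** Finitely many upward closed requirements, each met in a directed set, are met by one member.
    They will be the inequalities for the entries of a box. *)
Lemma directed_forall {T : Type} (le : T -> T -> Prop) (X : set T)
    (I : finType) (P : I -> T -> Prop) :
  (forall x y z, le x y -> le y z -> le x z) -> directed le X ->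
  (forall i x y, P i x -> le x y -> P i y) ->
  (forall i, exists2 d, X d & P i d) ->
  exists2 d, X d & forall i, P i d.
Proof.
move=> le_trans [[x0 Xx0] dirX] P_up ex.
have [d Xd dP] : exists2 d, X d & forall i, i \in enum I -> P i d.
  elim: (enum I) => [|i r [d Xd dP]]; first by exists x0.
  have [e Xe eP] := ex i; have [z [Xz dz ez]] := dirX _ _ Xd Xe.
  exists z => // j; rewrite in_cons => /orP[/eqP -> |/dP]; last first.
    by move/P_up; apply.
  exact: P_up ez.
by exists d => // i; apply: dP; rewrite mem_enum.
Qed.

Lemma exists_ratr_lt {R : realType} (e : R) :
  0 < e -> exists2 r : rat, 0 < r & ratr r < e.
Proof.
move=> /rat_in_itvoo[r]; rewrite in_itv/= => /andP[r0 re].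
by exists r => //; rewrite -(ltr0q R).
Qed.

(** * The way-below relation between boxes, and boxes moved by a margin *)

Section BoxOrder.
Context {R : realType} (B : {posnum rat}) (p q : nat).
Implicit Types (c d : ibox R B p q) (A : 'M[R]_(p, q)) (i : 'I_p) (j : 'I_q).

Local Notation k := (ratr B%:num : R).

Lemma bound_gt0 : 0 < k. Proof. by rewrite ltr0q. Qed.

Lemma lo_bset (al : box R p q) : bset al (lo al).
Proof. by move=> i j; rewrite lexx lo_le_hi. Qed.

Lemma hi_bset (al : box R p q) : bset al (hi al).
Proof. by move=> i j; rewrite lexx lo_le_hi. Qed.

Lemma lo_ibox_ge c i j : - k <= lo c i j.
Proof. by have /cubeE /(_ i j) /andP[] := @ibox_sub _ _ _ _ c _ (@lo_bset c). Qed.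

Lemma hi_ibox_le c i j : hi c i j <= k.
Proof. by have /cubeE /(_ i j) /andP[] := @ibox_sub _ _ _ _ c _ (@hi_bset c). Qed.

Lemma bleP c d :
  ble c d <-> forall i j, lo c i j <= lo d i j /\ hi d i j <= hi c i j.
Proof.
split=> [cd i j|cd A dA i j]; last first.
  have [? ?] := cd i j; have /andP[? ?] := dA i j.
  by apply/andP; split; apply: le_trans; eassumption.
by have /andP[-> _] := cd _ (@lo_bset d) i j; have /andP[_ ->] := cd _ (@hi_bset d) i j.
Qed.

Lemma ble_refl c : ble c c. Proof. exact: subset_refl. Qed.

Lemma ble_trans c d e : ble c d -> ble d e -> ble c e.
Proof. by move=> cd de; exact: subset_trans de cd. Qed.

Lemma ible_anti c d : ble c d -> ble d c -> c = d.
Proof.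
move=> /bleP cd /bleP dc.
case: c d cd dc => -[l h lh] cB [[l' h' lh'] dB] /= cd dc.
have ll : l = l'.
  by apply/matrixP => i j; apply/le_anti; rewrite (cd i j).1 (dc i j).1.
have hh : h = h'.
  by apply/matrixP => i j; apply/le_anti; rewrite (cd i j).2 (dc i j).2.
subst; rewrite (Prop_irrelevance lh lh') in cB *.
by rewrite (Prop_irrelevance cB dB).
Qed.

Lemma lo_bot i j : lo (@bbot R B p q) i j = - k.
Proof. by rewrite !mxE min_l// ge0_cp// ltW// bound_gt0. Qed.

Lemma hi_bot i j : hi (@bbot R B p q) i j = k.
Proof. by rewrite !mxE max_r// ge0_cp// ltW// bound_gt0. Qed.

Lemma ble_bot c : ble bbot c.
Proof. by apply/bleP => i j; rewrite lo_bot hi_bot lo_ibox_ge hi_ibox_le. Qed.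

Lemma lo_trunc (al : box R p q) i j : lo (trunc B al) i j = clamp k (lo al i j).
Proof. by rewrite !mxE min_l//; apply/le_clamp/lo_le_hi. Qed.

Lemma hi_trunc (al : box R p q) i j : hi (trunc B al) i j = clamp k (hi al i j).
Proof. by rewrite !mxE max_r//; apply/le_clamp/lo_le_hi. Qed.

(** Reordering and truncating turn any two matrices into an element of the domain, with no side
    condition to carry. *)
Definition ispan A A' : ibox R B p q := trunc B (bspan A A').

Lemma lo_ispan A A' i j :
  lo (ispan A A') i j = clamp k (Num.min (A i j) (A' i j)).
Proof. by rewrite lo_trunc mxE. Qed.

Lemma hi_ispan A A' i j :
  hi (ispan A A') i j = clamp k (Num.max (A i j) (A' i j)).
Proof. by rewrite hi_trunc mxE. Qed.

Lemma clamp_id (x : R) : - k <= x <= k -> clamp k x = x.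
Proof. by move=> /andP[? ?]; rewrite /clamp min_r// max_r. Qed.

(* Bounds lying on the boundary of the cube stay put, as they impose nothing on
   the boxes way above [c]; a negative [e] enlarges [c]. *)
Definition shrink (e : R) c : ibox R B p q :=
  ispan
    (\matrix_(i, j) if lo c i j == - k then - k else lo c i j + e)
    (\matrix_(i, j) if hi c i j == k then k else hi c i j - e).

Definition slack (e : R) c d : Prop := forall i j,
  (lo c i j = - k \/ lo c i j + e <= lo d i j) /\
  (hi c i j = k \/ hi d i j <= hi c i j - e).

(** The explicit form of way-below, see [bway_belowP]; [slack] is the same with a margin common to
    all entries. *)
Definition interior_sub c d : Prop := forall i j,
  (lo c i j = - k \/ lo c i j < lo d i j) /\
  (hi c i j = k \/ hi d i j < hi c i j).

Lemma interior_sub_slack e c d : 0 < e -> slack e c d -> interior_sub c d.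
Proof.
move=> e0 cd i j; have [H1 H2] := cd i j.
by split; [case: H1; [left|right; lra]|case: H2; [left|right; lra]].
Qed.

Lemma interior_sub_ble c d : interior_sub c d -> ble c d.
Proof.
move=> cd; apply/bleP => i j; have [H1 H2] := cd i j.
split; first by case: H1 => [->|/ltW//]; exact: lo_ibox_ge.
by case: H2 => [->|/ltW//]; exact: hi_ibox_le.
Qed.

Lemma slack_le e e' c d : e' <= e -> slack e c d -> slack e' c d.
Proof.
move=> ee cd i j; have [H1 H2] := cd i j.
by split; [case: H1; [left|right; lra]|case: H2; [left|right; lra]].
Qed.

Lemma slack_ble e c d d' : slack e c d -> ble d d' -> slack e c d'.
Proof.
move=> cd /bleP dd i j; have [H1 H2] := cd i j; have [? ?] := dd i j.
by split; [case: H1; [left|right; lra]|case: H2; [left|right; lra]].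
Qed.

Lemma ble_interior_sub c d e : ble c d -> interior_sub d e -> interior_sub c e.
Proof.
move=> /bleP cd de i j; have [H1 H2] := de i j; have [H3 H4] := cd i j.
have := lo_ibox_ge c i j; have := hi_ibox_le c i j => H5 H6.
split.
  case: H1 => H1; last by right; lra.
  by left; apply/le_anti; rewrite H6 -H1 H3.
case: H2 => H2; last by right; lra.
by left; apply/le_anti; rewrite H5 -H2 H4.
Qed.

Lemma interior_sub_trans c d e : interior_sub c d -> ble d e -> interior_sub c e.
Proof.
move=> cd /bleP de i j; have [H1 H2] := cd i j; have [H3 H4] := de i j.
by split; [case: H1; [left|right; lra]|case: H2; [left|right; lra]].
Qed.

(** The box [d] keeps the moved bounds inside the cube and in the right order, so the reordering and
    the truncation in [shrink] are idle. *)
Lemma shrink_bounds e c d : 0 <= e -> slack e c d -> forall i j,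
  lo (shrink e c) i j = (if lo c i j == - k then - k else lo c i j + e) /\
  hi (shrink e c) i j = (if hi c i j == k then k else hi c i j - e).
Proof.
move=> e0 cd i j; rewrite lo_ispan hi_ispan !mxE.
have [H1 H2] := cd i j; have H3 := lo_le_hi d i j; have k0 := bound_gt0.
have := lo_ibox_ge c i j; have := hi_ibox_le c i j => H4 H5.
have := lo_ibox_ge d i j; have := hi_ibox_le d i j => H6 H7.
set x := if _ then _ else _; set y := if _ then _ else _.
have xd : - k <= x <= lo d i j.
  rewrite /x; case: eqP => H; first by rewrite lexx.
  by case: H1 => // H1; rewrite H1 andbT; lra.
have yd : hi d i j <= y <= k.
  rewrite /y; case: eqP => H; first by rewrite lexx andbT.
  by case: H2 => // H2; rewrite H2 /=; lra.
rewrite min_l ?max_r; [|lra..].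
by rewrite !clamp_id//; apply/andP; split; lra.
Qed.

Lemma shrink_ble e c d : 0 <= e -> slack e c d -> ble (shrink e c) d.
Proof.
move=> e0 cd; apply/bleP => i j; have [-> ->] := shrink_bounds e0 cd i j.
have [H1 H2] := cd i j; split; case: eqP => H.
- exact: lo_ibox_ge.
- by case: H1.
- exact: hi_ibox_le.
- by case: H2.
Qed.

Lemma slack_shrink e e' c d : 0 <= e' -> slack e c d -> e' <= e ->
  slack e' c (shrink e' c).
Proof.
move=> e0 cd ee i j; have [-> ->] := shrink_bounds e0 (slack_le ee cd) i j.
by split; case: eqP; [left|right|left|right].
Qed.

Lemma slack_shrinkl e e' c d : 0 <= e -> 0 <= e' -> slack (e + e') c d ->
  slack e' (shrink e c) d.
Proof.
move=> e0 e'0 cd i j.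
have cd' : slack e c d by apply: slack_le cd; lra.
have [-> ->] := shrink_bounds e0 cd' i j.
have [H1 H2] := cd i j.
split; case: eqP => H; [by left| |by left|].
  by right; case: H1 => // H1; lra.
by right; case: H2 => // H2; lra.
Qed.

Lemma enlarge_bounds e c i j : 0 <= e ->
  lo (shrink (- e) c) i j = Num.max (- k) (lo c i j - e) /\
  hi (shrink (- e) c) i j = Num.min k (hi c i j + e).
Proof.
move=> e0; rewrite lo_ispan hi_ispan !mxE opprK.
have H3 := lo_le_hi c i j; have k0 := bound_gt0.
have := lo_ibox_ge c i j; have := hi_ibox_le c i j => H4 H5.
set x := if _ then _ else _; set y := if _ then _ else _.
have xy : x <= y by rewrite /x /y; case: eqP => ?; case: eqP => ?; lra.
rewrite (min_l xy) (max_r xy) /clamp; split.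
  have xk : x <= k by rewrite /x; case: eqP => ?; lra.
  by rewrite (min_r xk) /x; case: eqP => // H; rewrite H maxxx max_l//; lra.
have yk : - k <= Num.min k y.
  by rewrite le_min /y; apply/andP; split; last case: eqP => ?; lra.
by rewrite (max_r yk) /y; case: eqP => // H; rewrite H minxx min_l//; lra.
Qed.

Lemma enlarge_interior_sub e c : 0 < e -> interior_sub (shrink (- e) c) c.
Proof.
move=> e0 i j; have [-> ->] := enlarge_bounds c i j (ltW e0).
split.
  by case: (leP (- k)) => H; [right; lra|left].
by case: (leP k) => H; [left|right; lra].
Qed.

Lemma ble_enlarge e e' c : 0 <= e <= e' -> ble (shrink (- e') c) (shrink (- e) c).
Proof.
move=> /andP[e0 ee]; apply/bleP => i j.
have [-> ->] := enlarge_bounds c i j e0.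
have [-> ->] := enlarge_bounds c i j (le_trans e0 ee).
rewrite ge_max !le_max le_min !ge_min !lexx/=.
by split; apply/orP; right; lra.
Qed.

(** A failure of [ble c d] at some entry has a positive gap, and an enlargement by less than the gap
    still fails there. Rational margins suffice, and they keep rational boxes rational. *)
Lemma enlarge_sup c d :
  (forall e : rat, 0 < e -> ble (shrink (- ratr e) c) d) -> ble c d.
Proof.
move=> H; apply/bleP => i j.
rewrite !leNgt; split; apply/negP => lt.
  have [|e e0 ed] := @exists_ratr_lt R (lo c i j - lo d i j); first by lra.
  have e0' : 0 <= ratr e :> R by rewrite ler0q ltW.
  have /bleP/(_ i j)[+ _] := H e e0; rewrite (enlarge_bounds c i j e0').1 ge_max.
  by move=> /andP[_]; lra.
have [|e e0 ed] := @exists_ratr_lt R (hi d i j - hi c i j); first by lra.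
have e0' : 0 <= ratr e :> R by rewrite ler0q ltW.
have /bleP/(_ i j)[_] := H e e0; rewrite (enlarge_bounds c i j e0').2 le_min.
by move=> /andP[_]; lra.
Qed.

(** If no member of [X] exceeded [z] at this entry, lowering the bound of [s] to [z] would give an
    upper bound of [X] strictly below [s]. *)
Lemma lub_lo (X : set (ibox R B p q)) s i j (z : R) :
  X !=set0 -> is_lub setT ble X s -> z < lo s i j -> exists2 d, X d & z < lo d i j.
Proof.
move=> [x0 Xx0] [_ ub lub] zs; apply: contrapT => no.
have Xz d : X d -> lo d i j <= z.
  by move=> Xd; rewrite leNgt; apply/negP => zd; apply: no; exists d.
pose A : 'M[R]_(p, q) :=
  \matrix_(i', j') if (i' == i) && (j' == j) then z else lo s i' j'.
have loA i' j' : lo (ispan A (hi s)) i' j' = A i' j'.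
  rewrite lo_ispan !mxE; have := lo_ibox_ge s i' j'.
  have := hi_ibox_le s i' j'; have := lo_le_hi s i' j' => H1 H2 H3.
  case: ifP => [/andP[/eqP -> /eqP ->]|_]; last by rewrite min_l// clamp_id//; lra.
  (* A member of [X] shows that [z] is at least [- k], so that the clamp leaves it alone. *)
  have := Xz _ Xx0; have := lo_ibox_ge x0 i j => H4 H5.
  have := hi_ibox_le s i j; have := lo_le_hi s i j => H6 H7.
  by rewrite min_l ?clamp_id//; lra.
have hiA i' j' : hi (ispan A (hi s)) i' j' = hi s i' j'.
  rewrite hi_ispan !mxE; have := lo_ibox_ge s i' j'.
  have := hi_ibox_le s i' j'; have := lo_le_hi s i' j' => H1 H2 H3.
  case: ifP => [/andP[/eqP -> /eqP ->]|_]; last by rewrite max_r// clamp_id//; lra.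
  have := hi_ibox_le s i j; have := lo_le_hi s i j; have := lo_ibox_ge s i j.
  by move=> H4 H6 H7; rewrite max_r ?clamp_id//; lra.
have /bleP/(_ i j)[] : ble s (ispan A (hi s)).
  apply: lub => // d Xd; apply/bleP => i' j'; rewrite loA hiA mxE.
  have /bleP/(_ i' j')[H1 H2] := ub _ Xd; split=> //.
  by case: ifP => // /andP[/eqP -> /eqP ->]; exact: Xz.
by rewrite loA mxE !eqxx /= leNgt zs.
Qed.

Lemma lub_hi (X : set (ibox R B p q)) s i j (z : R) :
  X !=set0 -> is_lub setT ble X s -> hi s i j < z -> exists2 d, X d & hi d i j < z.
Proof.
move=> [x0 Xx0] [_ ub lub] zs; apply: contrapT => no.
have Xz d : X d -> z <= hi d i j.
  by move=> Xd; rewrite leNgt; apply/negP => zd; apply: no; exists d.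
pose A : 'M[R]_(p, q) :=
  \matrix_(i', j') if (i' == i) && (j' == j) then z else hi s i' j'.
have hiA i' j' : hi (ispan (lo s) A) i' j' = A i' j'.
  rewrite hi_ispan !mxE; have := lo_ibox_ge s i' j'.
  have := hi_ibox_le s i' j'; have := lo_le_hi s i' j' => H1 H2 H3.
  case: ifP => [/andP[/eqP -> /eqP ->]|_]; last by rewrite max_r// clamp_id//; lra.
  have := Xz _ Xx0; have := hi_ibox_le x0 i j => H4 H5.
  have := lo_ibox_ge s i j; have := lo_le_hi s i j => H6 H7.
  by rewrite max_r ?clamp_id//; lra.
have loA i' j' : lo (ispan (lo s) A) i' j' = lo s i' j'.
  rewrite lo_ispan !mxE; have := lo_ibox_ge s i' j'.
  have := hi_ibox_le s i' j'; have := lo_le_hi s i' j' => H1 H2 H3.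
  case: ifP => [/andP[/eqP -> /eqP ->]|_]; last by rewrite min_l// clamp_id//; lra.
  have := hi_ibox_le s i j; have := lo_le_hi s i j; have := lo_ibox_ge s i j.
  by move=> H4 H6 H7; rewrite min_l ?clamp_id//; lra.
have /bleP/(_ i j)[_] : ble s (ispan (lo s) A).
  apply: lub => // d Xd; apply/bleP => i' j'; rewrite loA hiA mxE.
  have /bleP/(_ i' j')[H1 H2] := ub _ Xd; split=> //.
  by case: ifP => // /andP[/eqP -> /eqP ->]; exact: Xz.
by rewrite hiA mxE !eqxx /= leNgt zs.
Qed.

(** From right to left, each entry is settled by one member of [X] and directedness combines them.
    From left to right, way-below is tested on the rational enlargements of [d], a directed set with
    supremum [d]. *)
Lemma bway_belowP c d : bway_below c d <-> interior_sub c d.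
Proof.
split=> [cd|cd X s _ dirX lubs ds]; last first.
  have cs := interior_sub_trans cd ds.
  have [d' Xd' H] : exists2 d', X d' & forall ij : 'I_p * 'I_q,
      lo c ij.1 ij.2 <= lo d' ij.1 ij.2 /\ hi d' ij.1 ij.2 <= hi c ij.1 ij.2.
    apply: (directed_forall _ dirX).
    - exact: ble_trans.
    - move=> ij x y [H1 H2] /bleP/(_ ij.1 ij.2)[H3 H4].
      by split; [exact: le_trans H3|exact: le_trans H2].
    - move=> [i j] /=; have [H1 H2] := cs i j.
      have X0 := dirX.1; have [x0 Xx0] := X0.
      have [d1 Xd1 P1] : exists2 d1, X d1 & lo c i j <= lo d1 i j.
        case: H1 => [->|/(lub_lo X0 lubs)[d1 Xd1 /ltW]]; last by exists d1.
        by exists x0 => //; exact: lo_ibox_ge.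
      have [d2 Xd2 P2] : exists2 d2, X d2 & hi d2 i j <= hi c i j.
        case: H2 => [->|/(lub_hi X0 lubs)[d2 Xd2 /ltW]]; last by exists d2.
        by exists x0 => //; exact: hi_ibox_le.
      have [z [Xz /bleP/(_ i j)[? _] /bleP/(_ i j)[_ ?]]] := dirX.2 _ _ Xd1 Xd2.
      by exists z => //; split; [exact: le_trans P1 _|exact: le_trans P2].
  by exists d' => //; apply/bleP => i j; exact: (H (i, j)).
pose X := [set shrink (- ratr e) d | e in [set e : rat | 0 < e]].
have e0 (e : rat) : 0 < e -> 0 < ratr e :> R by rewrite ltr0q.
have dirX : directed ble X.
  split=> [|_ _ [e e_gt0 <-] [e' e'_gt0 <-]]; first by exists (shrink (- ratr 1) d), 1.
  exists (shrink (- ratr (Num.min e e')) d); split.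
  - by exists (Num.min e e') => //=; rewrite lt_min e_gt0.
  - by apply: ble_enlarge; rewrite ler_rat ler0q le_min !ge_min lexx (ltW e_gt0) ltW.
  - by apply: ble_enlarge; rewrite ler_rat ler0q le_min !ge_min lexx orbT (ltW e_gt0) ltW.
have lubd : is_lub setT ble X d.
  split=> // [_ [e /e0 e_gt0 <-]|t _ ub].
    exact/interior_sub_ble/enlarge_interior_sub.
  by apply: enlarge_sup => e e_gt0; apply: ub; exists e.
have [_ [e /e0 e_gt0 <-] cm] := cd X d (@subsetT _ _) dirX lubd (@ble_refl d).
exact: ble_interior_sub cm (enlarge_interior_sub d e_gt0).
Qed.

End BoxOrder.

Section RationalBox.
Context {R : realType} (B : {posnum rat}) (p q : nat).

Definition is_ratr (x : R) : Prop := exists r : rat, x = ratr r.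

Lemma is_ratr_min x y : is_ratr x -> is_ratr y -> is_ratr (Num.min x y).
Proof. by move=> ? ?; rewrite /Num.min; case: ifP. Qed.

Lemma is_ratr_max x y : is_ratr x -> is_ratr y -> is_ratr (Num.max x y).
Proof. by move=> ? ?; rewrite /Num.max; case: ifP. Qed.

Lemma is_ratr_clamp x : is_ratr x -> is_ratr (clamp (ratr B%:num) x).
Proof.
move=> ?; apply: is_ratr_max; first by exists (- B%:num); rewrite rmorphN.
by apply: is_ratr_min => //; exists B%:num.
Qed.

Lemma rational_shrink (e : rat) (c : ibox R B p q) :
  rational_box c -> rational_box (shrink (ratr e) c).
Proof.
move=> rc i j; have [l [h [lE hE]]] := rc i j.
have Rlo : is_ratr (if lo c i j == - ratr B%:num then - ratr B%:num
                    else lo c i j + ratr e).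
  case: ifP => _; first by exists (- B%:num); rewrite rmorphN.
  by exists (l + e); rewrite rmorphD/= lE.
have Rhi : is_ratr (if hi c i j == ratr B%:num then ratr B%:num
                    else hi c i j - ratr e).
  case: ifP => _; first by exists B%:num.
  by exists (h - e); rewrite rmorphB/= hE.
have [l' l'E] := is_ratr_clamp (is_ratr_min Rlo Rhi).
have [h' h'E] := is_ratr_clamp (is_ratr_max Rlo Rhi).
by exists l', h'; rewrite lo_ispan hi_ispan !mxE.
Qed.

End RationalBox.

(** * Step functions *)

Section Steps.
Context {R : realType} (B : {posnum rat}) (p q : nat) (X : Type).
Implicit Types (N : nat) (O : nat -> set X) (b : nat -> ibox R B p q)
  (f g : X -> ibox R B p q).

Local Notation k := (ratr B%:num : R).

Lemma is_stepP N O b f : is_step ble bbot N O b f <-> forall x,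
  (forall l, (l < N)%N -> O l x -> ble (b l) (f x)) /\
  (forall d, (forall l, (l < N)%N -> O l x -> ble (b l) d) -> ble (f x) d).
Proof.
split=> [[_ ub lub] x|H].
  split=> [l lN Olx|d dP].
    have /(_ x) := ub _ (ex_intro2 _ _ l lN erefl).
    by case: asboolP.
  (* Changing [f] at the single point [x] gives the upper bound to compare with. *)
  pose g y := if `[< y = x >] then d else f y.
  have : pointwise ble f g.
    apply: lub => // _ [l lN <-] y; rewrite /g.
    case: (asboolP (y = x)) => [->|_]; last first.
      exact: ub (ex_intro2 _ _ l lN erefl) y.
    by case: asboolP => [/(dP _ lN)//|_]; exact: ble_bot.
  by move=> /(_ x); rewrite /g; case: (asboolP (x = x)).
split=> // [_ [l lN <-] x|g _ gP x].
  by case: asboolP => [|_]; [exact: (H x).1|exact: ble_bot].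
apply: (H x).2 => l lN Olx.
by have /(_ x) := gP _ (ex_intro2 _ _ l lN erefl); case: asboolP.
Qed.

(** Steps inactive at [x] enter with the bottom bound, which is neutral; the result is a finite
    maximum, which a recursive function can evaluate. *)
Definition step_lo N O b (x : X) i j : R :=
  \big[Num.max/- k]_(l < N) (if `[< O l x >] then lo (b l) i j else - k).

Definition step_hi N O b (x : X) i j : R :=
  \big[Num.min/k]_(l < N) (if `[< O l x >] then hi (b l) i j else k).

Definition step_box N O b (x : X) : ibox R B p q :=
  ispan B (\matrix_(i, j) step_lo N O b x i j) (\matrix_(i, j) step_hi N O b x i j).

(** A common upper bound [d] of the active boxes separates the maximum of the lower bounds from the
    minimum of the upper ones, so [ispan] alters neither. *)
Lemma step_box_bounds N O b x d : (forall l, (l < N)%N -> O l x -> ble (b l) d) ->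
  forall i j, lo (step_box N O b x) i j = step_lo N O b x i j /\
    hi (step_box N O b x) i j = step_hi N O b x i j /\
    step_lo N O b x i j <= lo d i j /\ hi d i j <= step_hi N O b x i j.
Proof.
move=> dP i j.
have lod : step_lo N O b x i j <= lo d i j.
  apply: bigmax_le => [|l _]; first exact: lo_ibox_ge.
  case: asboolP => [/(dP _ (ltn_ord l))/bleP/(_ i j)[]//|_]; exact: lo_ibox_ge.
have hid : hi d i j <= step_hi N O b x i j.
  apply: le_bigmin => [|l _]; first exact: hi_ibox_le.
  case: asboolP => [/(dP _ (ltn_ord l))/bleP/(_ i j)[]//|_]; exact: hi_ibox_le.
have lok : - k <= step_lo N O b x i j by exact: bigmax_ge_id.
have hik : step_hi N O b x i j <= k by exact: bigmin_le_id.
have dd := lo_le_hi d i j.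
rewrite lo_ispan hi_ispan !mxE min_l ?max_r; [|lra..].
by rewrite !clamp_id//; lra.
Qed.

Lemma is_step_box N O b :
  (forall x, exists d, forall l, (l < N)%N -> O l x -> ble (b l) d) ->
  is_step ble bbot N O b (step_box N O b).
Proof.
move=> H; apply/is_stepP => x; have [d dP] := H x; split=> [l lN Olx|e eP].
  apply/bleP => i j; have [-> [-> _]] := step_box_bounds dP i j; split.
    have /= := le_bigmax (- k) (fun l : 'I_N =>
      if `[< O l x >] then lo (b l) i j else - k) (Ordinal lN).
    by case: asboolP.
  have /= := bigmin_le k (Ordinal lN) (fun l : 'I_N =>
    if `[< O l x >] then hi (b l) i j else k).
  by case: asboolP.
by apply/bleP => i j; have [-> [-> []]] := step_box_bounds eP i j.
Qed.

Lemma is_step_uniq N O b f g :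
  is_step ble bbot N O b f -> is_step ble bbot N O b g -> f = g.
Proof.
move=> [_ fub flub] [_ gub glub]; apply/funext => x; apply: ible_anti.
  exact: flub.
exact: glub.
Qed.

Lemma is_step_lo N O b f x i j : is_step ble bbot N O b f ->
  lo (f x) i j = step_lo N O b x i j /\ hi (f x) i j = step_hi N O b x i j.
Proof.
move=> fP; have H y := (is_stepP N O b f).1 fP y.
rewrite (is_step_uniq fP (is_step_box (fun y => ex_intro _ (f y) (H y).1))).
by have [-> [-> _]] := step_box_bounds (H x).1 i j.
Qed.

End Steps.

(** * Rounded ideals *)

Lemma exists_uniform_gap {R : realType} (I : finType) (f g : I -> R) :
  exists2 e : rat, 0 < e & forall i, f i < g i -> f i + ratr e <= g i.
Proof.
have [|e e0 eP] := @exists_ratr_lt R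
    (\big[Num.min/1]_(i | f i < g i) (g i - f i)).
  by apply: lt_bigmin => // i; rewrite subr_gt0.
exists e => // i fg.
have := bigmin_le_cond 1 (fun i => g i - f i) (fg : (fun i => f i < g i) i).
by lra.
Qed.

Lemma finite_set_choice_ind {T : Type} (P : set T -> Prop) (A : set T) :
  finite_set A ->
  P set0 -> (forall x B, A x -> B `<=` A -> P B -> P (x |` B)) -> P A.
Proof.
move=> /(@finite_seqP {classic T})[s sA] P0 PU.
suff H (r : seq {classic T}) : {subset r <= s} -> P [set` r].
  by rewrite sA; exact: H.
elim: r => [|x r IH] rs; first by rewrite set_nil.
have -> : [set` x :: r] = x |` [set` r].
  apply/seteqP; split=> y /=; rewrite in_cons.
    by move=> /orP[/eqP|]; [left|right].
  by move=> [->|->]; rewrite ?eqxx ?orbT.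
apply: PU.
- by rewrite sA /= rs// mem_head.
- by rewrite sA => y /= yr; rewrite rs// in_cons yr orbT.
- by apply: IH => y yr; rewrite rs// in_cons yr orbT.
Qed.

Section WD.
Context {R : realType} (K : {posnum rat}) (n : nat) (a : rat).

Local Notation D := (seg R a -> ibox R K n 1).
Implicit Types (f g x y z th : D) (N : nat) (p r : nat -> rat)
  (b : nat -> ibox R K n 1) (t : seg R a).

Lemma seg_oc_finite_inter N p r t : exists p0 r0 : rat, seg_oc p0 r0 t /\
  forall l, (l < N)%N -> seg_oc (p l) (r l) t ->
    @seg_oc R a p0 r0 `<=` seg_oc (p l) (r l).
Proof.
elim: N => [|N [p0 [r0 [t0 IH]]]].
  (* With no step to intersect, (-1, a] covers the whole segment, the point 0 included. *)
  exists (-1), a; split=> //; rewrite /seg_oc /=.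
  have := valP t; rewrite /= in_itv/= => /andP[H ->].
  by rewrite rmorphN1 (lt_le_trans _ H)// ltrN10.
have [tN|tN] := pselect (seg_oc (p N) (r N) t); last first.
  exists p0, r0; split=> // l; rewrite ltnS leq_eqVlt => /orP[/eqP ->//|].
  exact: IH.
exists (Num.max p0 (p N)), (Num.min r0 (r N)).
have sub : seg_oc (Num.max p0 (p N)) (Num.min r0 (r N)) `<=`
    @seg_oc R a p0 r0 `&` seg_oc (p N) (r N).
  move=> u; rewrite /seg_oc /= => /andP[pu ur]; split; apply/andP; split.
  - by apply: le_lt_trans pu; rewrite ler_rat le_max lexx.
  - by apply: le_trans ur _; rewrite ler_rat ge_min lexx.
  - by apply: le_lt_trans pu; rewrite ler_rat le_max lexx orbT.
  - by apply: le_trans ur _; rewrite ler_rat ge_min lexx orbT.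
split.
  move: t0 tN; rewrite /seg_oc /= => /andP[? ?] /andP[? ?].
  by rewrite /Num.max /Num.min; case: ifP => _; case: ifP => _; apply/andP.
move=> l; rewrite ltnS leq_eqVlt => /orP[/eqP -> _ u /sub[]//|lN tl u /sub[+ _]].
exact: IH.
Qed.

(** Steps active at [t] stay active on a basic neighbourhood, so the value there can only grow, and
    Scott open sets are upward closed. *)
Lemma BD_rep_BD N p r b th : BD_rep N p r b th -> BD R K n a th.
Proof.
move=> rep; split; last by exists N, p, r, b.
move: rep => [_ /is_stepP thP] U [Uup _] t Ut.
have [p0 [r0 [t0 H]]] := seg_oc_finite_inter N p r t.
exists p0, r0; split=> // u u0; apply: Uup Ut _.
by apply: (thP t).2 => l lN tl; apply: (thP u).1 => //; exact: (H _ lN tl).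
Qed.

(** This frees [tri0] from the choice of a representation. The bounds of [x t] are finite maxima and
    minima over the active steps, so strict inequalities valid for every step pass to them. *)
Lemma tri0P x y : tri0 x y <->
  [/\ BD R K n a x, BD R K n a y & forall t, interior_sub (x t) (y t)].
Proof.
split=> [[Bx By [N [p [r [b [[_ xP] H]]]]]]|[Bx By xy]]; split=> //; last first.
  move: (Bx) => [_ [N [p [r [b xP]]]]]; exists N, p, r, b; split=> // l lN t tl.
  apply/bway_belowP; apply: ble_interior_sub (xy t).
  by case: xP => _ /is_stepP /(_ t)[+ _]; apply.
move=> t i j; have [-> ->] := is_step_lo t i j xP.
have {}H l : (l < N)%N -> seg_oc (p l) (r l) t -> interior_sub (b l) (y t).
  by move=> lN /(H l lN) /bway_belowP.
have := lo_ibox_ge (y t) i j; have := hi_ibox_le (y t) i j => yhi ylo.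
split.
  case: (ltP (- ratr K%:num) (lo (y t) i j)) => [lt|le]; [right|left].
    apply: bigmax_lt => // l _; case: asboolP => // /(H _ (ltn_ord l)).
    by move=> /(_ i j)[[->|]].
  (* With the bound of [y t] on the boundary no strict inequality is possible, so all active steps
     have theirs on the boundary too. *)
  apply/le_anti; rewrite bigmax_ge_id andbT.
  apply: bigmax_le => // l _; case: asboolP => // /(H _ (ltn_ord l)).
  by move=> /(_ i j)[[->//|/ltW/le_trans]] => /(_ _ le).
case: (ltP (hi (y t) i j) (ratr K%:num)) => [lt|le]; [right|left].
  apply: lt_bigmin => // l _; case: asboolP => // /(H _ (ltn_ord l)).
  by move=> /(_ i j)[_ [->|]].
apply/le_anti; rewrite bigmin_le_id.
apply: le_bigmin => // l _; case: asboolP => // /(H _ (ltn_ord l)).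
by move=> /(_ i j)[_ [->//|/ltW/(le_trans le)]].
Qed.

Lemma tri0_fle x y : tri0 x y -> fle x y.
Proof. by move=> /tri0P[_ _ xy] t; exact: interior_sub_ble. Qed.

Lemma fle_tri0 x y z : BD R K n a x -> fle x y -> tri0 y z -> tri0 x z.
Proof.
move=> Bx xy /tri0P[_ Bz yz]; apply/tri0P; split=> // t.
exact: ble_interior_sub (xy t) (yz t).
Qed.

Lemma tri0_fle_trans x y z : BD R K n a z -> tri0 x y -> fle y z -> tri0 x z.
Proof.
move=> Bz /tri0P[Bx _ xy] yz; apply/tri0P; split=> // t.
exact: interior_sub_trans (xy t) (yz t).
Qed.

Lemma tri0_trans x y z : tri0 x y -> tri0 y z -> tri0 x z.
Proof.
move=> xy yz; apply: fle_tri0 (tri0_fle xy) yz.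
by case/tri0P : xy.
Qed.

Definition rep_slack (e : R) N p r b g : Prop := forall l, (l < N)%N ->
  forall t, seg_oc (p l) (r l) t -> slack e (b l) (g t).

(* Only finitely many bounds occur among the steps of [x] and [y], whence a
   uniform gap. *)
Lemma tri0_slack N p r b x y : BD_rep N p r b x -> tri0 x y ->
  exists2 e : rat, 0 < e & rep_slack (ratr e) N p r b y.
Proof.
move=> [_ xP] /tri0P[_ [_ [N' [p' [r' [b' [_ yP]]]]]] xy].
(* One index for each pair of steps, entry and side; the flag selects lower or upper bounds. *)
pose I := ('I_N * 'I_N' * 'I_n * 'I_1 * bool)%type.
pose f (u : I) : R := let: (l, l', i, j, s) := u in
  if s then lo (b l) i j else hi (b' l') i j.
pose g (u : I) : R := let: (l, l', i, j, s) := u in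
  if s then lo (b' l') i j else hi (b l) i j.
have [e e0 eP] := exists_uniform_gap f g.
exists e => // l lN t tl i j.
have /(_ i j)[H1 H2] : interior_sub (b l) (y t).
  by apply: ble_interior_sub (xy t); apply: ((is_stepP _ _ _ _).1 xP t).1.
have := lo_ibox_ge (b l) i j; have := hi_ibox_le (b l) i j => bhi blo.
have yP' := yP.
have {}yP l' : (l' < N')%N -> seg_oc (p' l') (r' l') t -> ble (b' l') (y t).
  exact: ((is_stepP _ _ _ _).1 yP t).1.
split.
  case: H1 => [|H1]; [by left|right].
  (* If the margin failed, no active step of [y] could have its lower bound above that of [b l],
     since it would then exceed it by [e]. Their maximum could not either, against [H1]. *)
  rewrite leNgt; apply/negP => lt; move: H1; apply/negP; rewrite -leNgt.
  rewrite (is_step_lo t i j yP').1; apply: bigmax_le => // l' _.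
  case: asboolP => // tl'; rewrite leNgt; apply/negP => lt'.
  have /bleP/(_ i j)[le' _] := yP _ (ltn_ord l') tl'.
  have := eP (Ordinal lN, l', i, j, true) lt'; rewrite /f/g/=; lra.
case: H2 => [|H2]; [by left|right].
rewrite leNgt; apply/negP => lt; move: H2; apply/negP; rewrite -leNgt.
rewrite (is_step_lo t i j yP').2; apply: le_bigmin => // l' _.
case: asboolP => // tl'; rewrite leNgt; apply/negP => lt'.
have /bleP/(_ i j)[_ le'] := yP _ (ltn_ord l') tl'.
have := eP (Ordinal lN, l', i, j, false) lt'; rewrite /f/g/=; lra.
Qed.

Lemma BD_rep_shrink N p r b x (e : rat) :
  BD_rep N p r b x -> forall l, (l < N)%N -> rational_box (shrink (ratr e) (b l)).
Proof. by move=> [rb _] l /rb; exact: rational_shrink. Qed.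

Lemma BD_rep_tri0 N p r b x g (e : R) : BD_rep N p r b x -> BD R K n a g ->
  0 < e -> rep_slack e N p r b g -> tri0 x g.
Proof.
move=> xP Bg e0 H; split=> //; first exact: BD_rep_BD xP.
exists N, p, r, b; split=> // l lN t tl.
exact/bway_belowP/(interior_sub_slack e0)/H.
Qed.

(** The margin comes from the interpolating step functions in [tri]. Conversely, moving the steps of
    [x] inwards by [e] yields a step function [tri0]-above [x] and still below [g]. *)
Lemma lowstarP N p r b x g : BD_rep N p r b x ->
  lowstar g x <-> exists2 e : rat, 0 < e & rep_slack (ratr e) N p r b g.
Proof.
move=> xP; split=> [[Bx [y [z [xy yz zg]]]]|[e e0 H]].
  have [e e0 H] := tri0_slack xP (fle_tri0 Bx xy yz).
  by exists e => // l lN t tl; exact: slack_ble (H l lN t tl) (zg t).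
have e0' : 0 < ratr e :> R by rewrite ltr0q.
pose b' l := shrink (ratr e) (b l).
have b'g l : (l < N)%N -> forall t, seg_oc (p l) (r l) t -> ble (b' l) (g t).
  by move=> lN t tl; apply: shrink_ble (ltW e0') _; exact: H.
pose z : D := step_box N (fun l => seg_oc (p l) (r l)) b'.
have zP : BD_rep N p r b' z.
  split; first exact: BD_rep_shrink xP.
  by apply: is_step_box => t; exists (g t) => l lN; exact: b'g.
have Bx := BD_rep_BD xP.
split=> //; exists x, z; split=> [t||t]; first exact: ble_refl.
  apply: (BD_rep_tri0 xP (BD_rep_BD zP) e0') => l lN t tl.
  apply: slack_ble (((is_stepP _ _ _ _).1 zP.2 t).1 l lN tl).
  exact: slack_shrink (ltW e0') (H l lN t tl) (lexx _).
by apply: ((is_stepP _ _ _ _).1 zP.2 t).2 => l lN tl; exact: b'g.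
Qed.

Lemma lowstar_tri0 x y g : tri0 x y -> lowstar g y -> lowstar g x.
Proof.
move=> xy [_ [u [w [yu uw wg]]]]; have /tri0P[Bx _ _] := xy.
split=> //; exists y, w; split=> //; first exact: tri0_fle.
apply: fle_tri0 yu uw.
by case: xy.
Qed.

Lemma lowstar_bot g : lowstar g (fun=> bbot).
Proof.
have P : BD_rep 0 (fun=> 0) (fun=> 0) (fun=> bbot) ((fun=> bbot) : D).
  by split=> //; apply/is_stepP => t; split=> // d _; exact: ble_bot.
by apply/(lowstarP _ P); exists 1.
Qed.

Lemma lowstar_directed g x y : lowstar g x -> lowstar g y ->
  exists2 z, lowstar g z & tri0 x z /\ tri0 y z.
Proof.
move=> gx gy.
have [_ [N1 [p1 [r1 [b1 xP]]]]] := gx.1.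
have [_ [N2 [p2 [r2 [b2 yP]]]]] := gy.1.
have [e1 e10 H1] := (lowstarP g xP).1 gx.
have [e2 e20 H2] := (lowstarP g yP).1 gy.
(* One half of the margin puts [z] strictly above [x] and [y]; the other half remains as the margin
   of [z] below [g]. *)
pose e := Num.min e1 e2 / 2.
have e0 : 0 < e by rewrite divr_gt0// lt_min e10.
have e0' : 0 < ratr e :> R by rewrite ltr0q.
have ee : ratr e + ratr e = ratr (Num.min e1 e2) :> R.
  by rewrite -rmorphD /e -splitr.
have {}H1 : rep_slack (ratr e + ratr e) N1 p1 r1 b1 g.
  move=> l lN t tl; apply: slack_le (H1 l lN t tl).
  by rewrite ee ler_rat ge_min lexx.
have {}H2 : rep_slack (ratr e + ratr e) N2 p2 r2 b2 g.
  move=> l lN t tl; apply: slack_le (H2 l lN t tl).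
  by rewrite ee ler_rat ge_min lexx orbT.
(* Concatenates the two families of steps. *)
pose sel T (f1 f2 : nat -> T) l := if (l < N1)%N then f1 l else f2 (l - N1)%N.
pose p := sel _ p1 p2; pose r := sel _ r1 r2; pose b := sel _ b1 b2.
pose N := (N1 + N2)%N.
have H : rep_slack (ratr e + ratr e) N p r b g.
  move=> l lN t; rewrite /p /r /b /sel; case: ltnP => lN1 tl; first exact: H1.
  by apply: H2 => //; rewrite ltn_subLR.
have rb l : (l < N)%N -> rational_box (shrink (ratr e) (b l)).
  move=> lN; rewrite /b /sel; case: ltnP => lN1; apply: rational_shrink.
    exact: xP.1.
  by apply: yP.1; rewrite ltn_subLR.
pose b' l := shrink (ratr e) (b l).
pose z : D := step_box N (fun l => seg_oc (p l) (r l)) b'.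
have zP : BD_rep N p r b' z.
  split=> //; apply: is_step_box => t; exists (g t) => l lN tl.
  apply: shrink_ble (ltW e0') (slack_le _ (H l lN t tl)); lra.
have Hz : rep_slack (ratr e) N p r b z.
  move=> l lN t tl.
  apply: slack_ble (((is_stepP _ _ _ _).1 zP.2 t).1 l lN tl).
  apply: slack_shrink (ltW e0') (H l lN t tl) _; lra.
exists z.
  apply/(lowstarP _ zP); exists e => // l lN t tl.
  exact: slack_shrinkl (ltW e0') (ltW e0') (H l lN t tl).
have Bz := BD_rep_BD zP.
split; [apply: (BD_rep_tri0 xP Bz e0')|apply: (BD_rep_tri0 yP Bz e0')].
  move=> l lN t tl; have := Hz l; rewrite /p /r /b /sel lN.
  by apply=> //; exact: leq_trans lN (leq_addr _ _).
move=> l lN t tl; have := Hz (N1 + l)%N.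
rewrite /N ltn_add2l /p /r /b /sel (ltnNge _ N1) leq_addr addKn; exact.
Qed.

Lemma lowstar_WD g : WD R K n a (lowstar g).
Proof.
split; [by exists (fun=> bbot); exact: lowstar_bot|by move=> x []| |].
  by move=> x y; exact: lowstar_tri0.
move=> A finA Ag; apply: (@finite_set_choice_ind _
    (fun B => exists2 z, lowstar g z & forall x, B x -> tri0 x z) A finA).
  by exists (fun=> bbot); [exact: lowstar_bot|].
move=> x B Ax _ [y gy yP].
have [z gz [xz yz]] := lowstar_directed (Ag _ Ax) gy.
by exists z => // u [->//|/yP/tri0_trans]; exact.
Qed.

Lemma iD_lowstar z : BD R K n a z -> iD z = lowstar z.
Proof.
move=> Bz; apply/seteqP; split=> [x xz|x [Bx [u [w [xu uw wz]]]]].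
  split; first by case: xz.
  by exists x, z; split=> // t; exact: ble_refl.
exact: fle_tri0 Bx xu (tri0_fle_trans Bz uw wz).
Qed.

(** Enlarging the steps of [x] by a rational [e] gives a step function [tri0]-below [x], hence below
    [g]; small [e] recover the steps themselves. *)
Lemma iD_sup x g : BD R K n a x -> (forall y, tri0 y x -> fle y g) -> fle x g.
Proof.
move=> Bx H t; have [_ [N [p [r [b xP]]]]] := Bx.
apply: ((is_stepP _ _ _ _).1 xP.2 t).2 => l lN tl.
apply: enlarge_sup => e e0.
have e0' : 0 < ratr e :> R by rewrite ltr0q.
pose b' l := shrink (- ratr e) (b l).
have b'x l' u : (l' < N)%N -> seg_oc (p l') (r l') u -> interior_sub (b' l') (x u).
  move=> lN' ul'; apply: interior_sub_trans (enlarge_interior_sub _ e0') _.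
  by apply: ((is_stepP _ _ _ _).1 xP.2 u).1.
pose z : D := step_box N (fun l => seg_oc (p l) (r l)) b'.
have zP : BD_rep N p r b' z.
  split; first by move=> l' lN'; rewrite /b' -rmorphN; exact: BD_rep_shrink xP _ _.
  apply: is_step_box => u; exists (x u) => l' lN' ul'.
  exact/interior_sub_ble/b'x.
have zx : tri0 z x.
  split=> //; first exact: BD_rep_BD zP.
  exists N, p, r, b'; split=> // l' lN' u ul'.
  exact/bway_belowP/b'x.
apply: ble_trans (H _ zx t).
exact: ((is_stepP _ _ _ _).1 zP.2 t).1.
Qed.

Lemma upstar_iD x : BD R K n a x -> upstar (iD x) = x.
Proof.
move=> Bx; have lubx : is_lub (DQ R K n a) (@fle R K n a) (iD x) x.
  split; [by case: Bx|by move=> y; exact: tri0_fle|].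
  by move=> g _ H; exact: iD_sup.
rewrite /upstar; apply: (@xget_unique {classic D}) => // g [Dg ub lub].
apply/funext => t; apply: ible_anti.
  by apply: lub => [|y /tri0_fle//]; case: Bx.
exact: iD_sup.
Qed.

(** By directedness, a finite subset of the union already lies in one member. *)
Lemma WD_directed_union (X : set (set D)) :
  X `<=` WD R K n a -> directed subset X -> WD R K n a (\bigcup_(d in X) d).
Proof.
move=> XW [[d0 Xd0] dirX]; split.
- by have [[x dx] _ _ _] := XW _ Xd0; exists x, d0.
- by move=> x [d Xd dx]; have [_ + _ _] := XW _ Xd; exact.
- move=> x y xy [d Xd dy]; exists d => //; have [_ _ H _] := XW _ Xd; exact: H xy dy.
move=> A finA AX.
have [d Xd Ad] : exists2 d, X d & A `<=` d.
  apply: (@finite_set_choice_ind _ (fun B => exists2 d, X d & B `<=` d) A finA).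
    by exists d0.
  move=> x B /AX[e Xe ex] _ [d Xd Bd].
  have [w [Xw dw ew]] := dirX _ _ Xd Xe.
  by exists w => // y [->|/Bd /dw//]; exact: ew.
have [_ _ _ /(_ _ finA Ad)[z dz Az]] := XW _ Xd.
by exists z => //; exists d.
Qed.

Lemma WD_tri0_up phi x : WD R K n a phi -> phi x -> exists2 z, phi z & tri0 x z.
Proof.
move=> [_ _ _ H] px; have [|y -> //|z pz H'] := H [set x]; first exact: finite_set1.
by exists z => //; exact: H'.
Qed.

(** An ideal is the directed union of the [iD z] of its members, so way-below puts [iD x] inside
    some [iD z]. Then [x] lies below [z] by [iD_sup], and roundedness supplies a member of [phi]
    strictly above [z]. Conversely, the union of a directed family is its supremum, so [x] lies in
    one of its members. *)
Lemma iD_way_below x phi : BD R K n a x -> WD R K n a phi ->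
  way_below (WD R K n a) subset (iD x) phi <-> phi x.
Proof.
move=> Bx Wphi; split=> [wb|px X s XW dirX [Ws ub lub] phis]; last first.
  have /(_ _ (phis _ px))[d Xd dx] : s `<=` \bigcup_(d in X) d.
    by apply: lub => [|d Xd y dy]; [exact: WD_directed_union|exists d].
  by exists d => // y yx; have [_ _ H _] := XW _ Xd; exact: H yx dx.
have [[y0 py0] phiB phi_lower phi_fin] := Wphi.
pose X := [set iD z | z in phi].
have XW : X `<=` WD R K n a.
  by move=> _ [z pz <-]; rewrite iD_lowstar; [exact: lowstar_WD|exact: phiB].
have dirX : directed subset X.
  split=> [|_ _ [z pz <-] [w pw <-]]; first by exists (iD y0), y0.
  have [||u pu H] := phi_fin [set z; w]; first exact: finite_set2.
    by move=> _ [->|->].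
  exists (iD u); split; first by exists u.
    by move=> y /tri0_trans; apply; apply: H; left.
  by move=> y /tri0_trans; apply; apply: H; right.
have lubX : is_lub (WD R K n a) subset X phi.
  split=> // [_ [z pz <-] y yz|psi _ ub y py]; first exact: phi_lower yz pz.
  have [z pz yz] := WD_tri0_up Wphi py.
  by apply: (ub (iD z)) => //; exists z.
have [_ [z pz <-] xz] := wb X phi XW dirX lubX (@subset_refl _ _).
have [w pw zw] := WD_tri0_up Wphi pz.
apply: phi_lower pw; apply: fle_tri0 zw => //.
by apply: iD_sup => // y /xz; exact: tri0_fle.
Qed.

End WD.

(** * The operator on one piece of the partition *)

Section Quadratic.
Context {R : realType}.
Implicit Types A B C q u v s t x c d : R.

Lemma Rintegral_affine q x c d : q < x ->
  Rintegral lebesgue_measure `[q, x] (fun t => c + (t - q) * d) =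
  (x - q) * c + (x - q) ^+ 2 / 2 * d.
Proof.
move=> qx.
pose F t := c * (t - q) + d / 2 * (t - q) ^+ 2.
have dF t : is_derive t 1 F (c + (t - q) * d).
  rewrite /F; apply: is_derive_eq.
  by rewrite /GRing.scale /=; lra.
have cF t : F @ t --> F t.
  by apply: differentiable_continuous; apply/derivable1_diffP.
rewrite /Rintegral (@continuous_FTC2 R _ F)//.
- by rewrite /F /=; lra.
- apply: continuous_subspaceT => t.
  apply: cvgD; first exact: cvg_cst.
  by apply: cvgMl; apply: cvgB => //; exact: cvg_cst.
- split; [by move=> t _|..].
    exact: cvg_at_right_filter.
  exact: cvg_at_left_filter.
- by move=> t _; rewrite derive1E; exact: derive_val.
Qed.

(* The last four cases: concave, vertex left of [u], vertex right of [v], no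
   sign change. *)
Definition quad_nonneg A B C u v : bool :=
  [&& 0 <= A + B * u + C * u ^+ 2, 0 <= A + B * v + C * v ^+ 2 &
    [|| C <= 0, 0 <= B + 2 * C * u, B + 2 * C * v <= 0 | B ^+ 2 <= 4 * A * C]].

Lemma quad_nonneg_left A B C u v : u < v ->
  (forall s, u < s <= v -> 0 <= A + B * s + C * s ^+ 2) ->
  0 <= A + B * u + C * u ^+ 2.
Proof.
move=> uv H; rewrite leNgt; apply/negP => hu.
(* [L] bounds the slopes of the chords from [u] of length at most 1, and [t] is so small that moving
   by [t] regains at most half of the negative value at [u]. *)
pose L := `|B + 2 * C * u| + `|C| + 1.
have L0 : 0 < L by rewrite /L ltr_wpDl.
pose t := Num.min (Num.min 1 (v - u)) (- (A + B * u + C * u ^+ 2) / (2 * L)).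
have t0 : 0 < t.
  rewrite !lt_min ltr01 subr_gt0 uv divr_gt0// ?oppr_gt0//.
  by rewrite mulr_gt0.
have t1 : t <= 1 by rewrite /t !ge_min lexx.
have tv : t <= v - u by rewrite /t !ge_min lexx orbT.
have tL : t * (2 * L) <= - (A + B * u + C * u ^+ 2).
  by rewrite -ler_pdivlMr ?mulr_gt0// /t !ge_min lexx !orbT.
have := H (u + t); rewrite ltrDl t0 -lerBrDl tv => /(_ isT).
have -> : A + B * (u + t) + C * (u + t) ^+ 2 =
  (A + B * u + C * u ^+ 2) + t * (B + 2 * C * u + t * C) by ring.
have : t * (B + 2 * C * u + t * C) <= t * L.
  rewrite ler_pM2l// /L.
  have := ler_norm (B + 2 * C * u).
  have : t * C <= `|C|.
    apply: le_trans (ler_norm _) _; rewrite normrM (gtr0_norm t0).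
    by rewrite ler_piMl.
  by lra.
by nra.
Qed.

Lemma quad_nonnegP A B C u v : u < v ->
  (forall s, u < s <= v -> 0 <= A + B * s + C * s ^+ 2) <->
  quad_nonneg A B C u v.
Proof.
move=> uv; split=> [H|/and3P[hu hv /or4P hC] s /andP[us sv]].
  apply/and3P; split; [exact: quad_nonneg_left H|by apply: H; rewrite uv lexx|].
  case: (leP C 0) => //= C0; case: (leP 0 (B + 2 * C * u)) => //= Bu.
  case: (leP (B + 2 * C * v) 0) => //= Bv.
  (* A convex polynomial with its vertex strictly inside the interval: its value there has the sign
     of [4 * A * C - B ^+ 2]. *)
  have := H (- B / (2 * C)).
  rewrite ltr_pdivlMr ?mulr_gt0// ler_pdivrMr ?mulr_gt0//.
  have -> : u * (2 * C) < - B by lra.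
  have -> : - B <= v * (2 * C) by lra.
  move=> /(_ isT).
  have -> : A + B * (- B / (2 * C)) + C * (- B / (2 * C)) ^+ 2 =
    (4 * A * C - B ^+ 2) / (4 * C) by field; rewrite gt_eqF.
  by rewrite pmulr_lge0 ?invr_gt0 ?mulr_gt0// subr_ge0.
case: (leP C 0) => C0.
  (* Concave case: the chord through both ends plus a nonnegative term. *)
  have -> : A + B * s + C * s ^+ 2 =
    ((v - s) * (A + B * u + C * u ^+ 2) + (s - u) * (A + B * v + C * v ^+ 2)
     - C * ((v - s) * (s - u) * (v - u))) / (v - u).
    by field; rewrite subr_eq0 gt_eqF.
  apply: divr_ge0; last by lra.
  have h1 : 0 <= (v - s) * (A + B * u + C * u ^+ 2) by apply: mulr_ge0 => //; lra.
  have h2 : 0 <= (s - u) * (A + B * v + C * v ^+ 2) by apply: mulr_ge0 => //; lra.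
  have h3 : 0 <= (v - s) * (s - u) * (v - u) by rewrite !mulr_ge0//; lra.
  have h4 : 0 <= - C * ((v - s) * (s - u) * (v - u)) by apply: mulr_ge0 => //; lra.
  by lra.
case: hC => hC; first by lra.
(* Expansion around the end nearer to the vertex, here [u] and below [v]; every term is
   nonnegative. *)
- have -> : A + B * s + C * s ^+ 2 = A + B * u + C * u ^+ 2 +
    (s - u) * (B + 2 * C * u + C * (s - u)) by ring.
  apply: addr_ge0 => //; apply: mulr_ge0; first by lra.
  by apply: addr_ge0 => //; apply: mulr_ge0; lra.
- have -> : A + B * s + C * s ^+ 2 = A + B * v + C * v ^+ 2 +
    (v - s) * (- (B + 2 * C * v) + C * (v - s)) by ring.
  apply: addr_ge0 => //; apply: mulr_ge0; first by lra.
  by apply: addr_ge0; [lra|apply: mulr_ge0; lra].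
(* Completing the square, after multiplication by [4 * C]. *)
- rewrite -(pmulr_rge0 _ C0) -(@pmulr_rge0 _ 4)//.
  have -> : 4 * (C * (A + B * s + C * s ^+ 2)) =
    (2 * C * s + B) ^+ 2 + (4 * A * C - B ^+ 2) by ring.
  by apply: addr_ge0; [exact: sqr_ge0|rewrite subr_ge0].
Qed.

Lemma le_clamp_iff (k y z : R) : - k < z -> z <= clamp k y <-> z <= k /\ z <= y.
Proof.
move=> kz; rewrite /clamp le_max le_min (leNgt z (- k)) kz /=.
by split=> [/andP|[-> ->]].
Qed.

Lemma clamp_le_iff (k y z : R) : z < k ->
  clamp k y <= z <-> - k <= z /\ y <= z.
Proof.
move=> zk; rewrite /clamp ge_max ge_min (leNgt k z) zk /=.
by split=> [/andP|[-> ->]].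
Qed.

End Quadratic.

Section PhiPieces.
Context {R : realType} (K M M1 : {posnum rat}) (n : nat) (a : rat).

Lemma badd_bounds p q (al be : box R p q) i j :
  lo (badd al be) i j = lo al i j + lo be i j /\
  hi (badd al be) i j = hi al i j + hi be i j.
Proof.
have H := lo_le_hi al i j; have H' := lo_le_hi be i j.
have le : lo al i j + lo be i j <= hi al i j + hi be i j by exact: lerD.
by rewrite /= !mxE (min_l le) (max_r le).
Qed.

Lemma bscale_bounds p q (t : R) (al : box R p q) i j : 0 <= t ->
  lo (bscale t al) i j = t * lo al i j /\ hi (bscale t al) i j = t * hi al i j.
Proof.
move=> t0; have le : t * lo al i j <= t * hi al i j.
  by apply: ler_wpM2l => //; exact: lo_le_hi.
by rewrite /= !mxE (min_l le) (max_r le).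
Qed.

Lemma bintE p q (s t : R) (g : R -> box R p q) i j :
  let l := Rintegral lebesgue_measure `[s, t] (fun x => lo (g x) i j) in
  let h := Rintegral lebesgue_measure `[s, t] (fun x => hi (g x) i j) in
  lo (bint s t g) i j = Num.min l h /\ hi (bint s t g) i j = Num.max l h.
Proof.
rewrite /= mxE [X in _ /\ X = _]mxE.
by split; [congr Num.min|congr Num.max]; rewrite mxE.
Qed.

(** On [s, x] the factor [t - s] is nonnegative, so scaling and integration keep the bounds in order
    and [bspan] reorders nothing. *)
Lemma bint_affine p q (s x : R) (u m : box R p q) i j : s < x ->
  let g t := badd u (bscale (t - s) m) in
  lo (bint s x g) i j = (x - s) * lo u i j + (x - s) ^+ 2 / 2 * lo m i j /\
  hi (bint s x g) i j = (x - s) * hi u i j + (x - s) ^+ 2 / 2 * hi m i j.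
Proof.
move=> sx g.
have gE t : t \in `[s, x]%R -> lo (g t) i j = lo u i j + (t - s) * lo m i j /\
    hi (g t) i j = hi u i j + (t - s) * hi m i j.
  rewrite in_itv/= => /andP[st _]; rewrite -subr_ge0 in st.
  have [-> ->] := badd_bounds u (bscale (t - s) m) i j.
  by have [-> ->] := bscale_bounds m i j st.
have loE : Rintegral lebesgue_measure `[s, x] (fun t => lo (g t) i j) =
    (x - s) * lo u i j + (x - s) ^+ 2 / 2 * lo m i j.
  rewrite -Rintegral_affine//; apply: eq_Rintegral => t; rewrite inE/= => /gE[].
  by [].
have hiE : Rintegral lebesgue_measure `[s, x] (fun t => hi (g t) i j) =
    (x - s) * hi u i j + (x - s) ^+ 2 / 2 * hi m i j.
  rewrite -Rintegral_affine//; apply: eq_Rintegral => t; rewrite inE/= => /gE[].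
  by [].
have le : (x - s) * lo u i j + (x - s) ^+ 2 / 2 * lo m i j <=
    (x - s) * hi u i j + (x - s) ^+ 2 / 2 * hi m i j.
  have := lo_le_hi u i j; have := lo_le_hi m i j => ? ?.
  apply: lerD; apply: ler_wpM2l => //; first by rewrite subr_ge0 ltW.
  by rewrite divr_ge0// sqr_ge0.
have [e1 e2] := bintE s x g i j.
clearbody g; by rewrite e1 e2 loE hiE (min_l le) (max_r le).
Qed.

(** [Phi] on one piece, with the search for the piece removed and the box at the node made a
    parameter. *)
Definition piece (w : V1 R K M M1 n) (q Delta : R) (al : ibox R K n 1) (x : R) :
    ibox R K n 1 :=
  let be := trunc K (boplus al (ratr M%:num * Delta)) in
  trunc K (badd al (bint q x (fun t =>
    badd (fld w al) (bscale (t - q) (bmul (dfld w be) (fld w be)))))).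

Lemma piece_bounds w q Delta (al : ibox R K n 1) x i j : q < x ->
  let be := trunc K (boplus al (ratr M%:num * Delta)) in
  let m := bmul (dfld w be) (fld w be) in
  lo (piece w q Delta al x) i j = clamp (ratr K%:num)
    (lo al i j + lo (fld w al) i j * (x - q) + lo m i j / 2 * (x - q) ^+ 2) /\
  hi (piece w q Delta al x) i j = clamp (ratr K%:num)
    (hi al i j + hi (fld w al) i j * (x - q) + hi m i j / 2 * (x - q) ^+ 2).
Proof.
move=> qx be m.
pose al' := bint q x (fun t => badd (fld w al) (bscale (t - q) m)).
have [l1 h1] : lo al' i j = _ /\ hi al' i j = _ :=
  bint_affine (fld w al) m i j qx.
have [l2 h2] := badd_bounds al al' i j.
split; [apply: etrans (lo_trunc K (badd al al') i j) _
       |apply: etrans (hi_trunc K (badd al al') i j) _].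
  by rewrite l2 l1; congr (clamp _ _); clear; ring.
by rewrite h2 h1; congr (clamp _ _); clear; ring.
Qed.

Variables (Q : seq rat).
Hypothesis Qpart : is_partition a Q.

Lemma node_lt i j : (i < j < size Q)%N -> Q`_i < Q`_j.
Proof.
move=> /andP[ij jQ]; have [_ _ _ sQ] := Qpart.
by apply: (sorted_ltn_nth lt_trans) => //; rewrite inE//; exact: ltn_trans jQ.
Qed.

Lemma node_le i j : (i <= j < size Q)%N -> Q`_i <= Q`_j.
Proof.
move=> /andP[]; rewrite leq_eqVlt => /orP[/eqP ->//|ij jQ].
by rewrite ltW// node_lt// ij.
Qed.

Lemma node0 : Q`_0 = 0.
Proof. by rewrite nth0; case: Qpart. Qed.

Lemma node_last : Q`_(size Q).-1 = a.
Proof. by rewrite nth_last; case: Qpart. Qed.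

Lemma node_bound j : (j < size Q)%N -> 0 <= Q`_j <= a.
Proof.
move=> jQ; rewrite -{1}node0 -node_last.
have Q0 : (0 < size Q)%N by exact: leq_ltn_trans jQ.
by rewrite !node_le// ?jQ// ltn_predL Q0 -ltnS prednK// jQ.
Qed.

Lemma find_piece j (x : seg R a) :
  (j.+1 < size Q)%N -> ratr Q`_j < val x <= ratr Q`_j.+1 ->
  find (fun q => val x <= ratr q) Q = j.+1.
Proof.
move=> jQ /andP[jx xj].
set P := fun q => _.
have : (find P Q <= j.+1)%N.
  by rewrite leqNgt; apply/negP => /(before_find 0); rewrite /P xj.
rewrite leq_eqVlt => /orP[/eqP//|]; rewrite ltnS => le.
have fQ : (find P Q < size Q)%N by exact: leq_ltn_trans le (ltnW jQ).
have /(nth_find 0) : has P Q by rewrite has_find.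
rewrite /P => xf; have : Q`_(find P Q) <= Q`_j by rewrite node_le// le ltnW.
by rewrite -(ler_rat R) => /(le_trans xf); rewrite leNgt jx.
Qed.

Lemma find_zero (x : seg R a) :
  val x = 0 -> find (fun q => val x <= ratr q) Q = 0%N.
Proof.
move=> x0; have := node0; have [sQ _ _ _] := Qpart.
by case: Q sQ => // q0 r _ /= ->; rewrite x0 rmorph0 lexx.
Qed.

Lemma seg_cases (x : seg R a) : val x = 0 \/
  exists2 j, (j < (size Q).-1)%N & ratr Q`_j < val x <= ratr Q`_j.+1.
Proof.
have := valP x; rewrite /= in_itv/= => /andP[x0 xa].
pose P q := val x <= ratr q.
have sQ : (1 < size Q)%N by case: Qpart.
have hP : has P Q.
  apply/(has_nthP 0); exists (size Q).-1; first by rewrite prednK// ltnW.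
  by rewrite node_last.
have := nth_find 0 hP; have := hP; rewrite has_find.
case fE : (find P Q) => [|j] jQ Pj.
  by left; apply/le_anti; rewrite x0 andbT; move: Pj; rewrite node0 /P rmorph0.
right; exists j; first by rewrite -ltnS prednK// ltnW.
rewrite [X in _ && X]Pj andbT ltNge.
have /(before_find 0) : (j < find P Q)%N by rewrite fE.
by rewrite /P => ->.
Qed.

End PhiPieces.

(** * Margins below the operator, as finitely many tests *)

Section PhiSlack.
Context {R : realType} (K M M1 : {posnum rat}) (n : nat) (a : rat).
Local Notation k := (ratr K%:num : R).

(** Comparing a bound with a truncated quadratic splits into a test of the constant against the cube
    and an inequality for the polynomial itself. The variable is [x - q], so [s] and [t] are offsets
    from the node. *)
Definition piece_slackb (e : R) (c : ibox R K n 1) (al u m : box R n 1)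
    (s t : R) (i : 'I_n) (j : 'I_1) : bool :=
  ((lo c i j == - k) || ((lo c i j + e <= k) &&
     quad_nonneg (lo al i j - (lo c i j + e)) (lo u i j) (lo m i j / 2) s t)) &&
  ((hi c i j == k) || ((- k <= hi c i j - e) &&
     quad_nonneg (hi c i j - e - hi al i j) (- hi u i j) (- (hi m i j / 2)) s t)).

(** As [e] is positive, a lower bound moved inwards exceeds [- k] and an upper one stays below [k];
    so only one side of each truncation matters. *)
Lemma slack_clamp (c d : ibox R K n 1) (e x y : R) i j : 0 < e ->
  lo d i j = clamp k x -> hi d i j = clamp k y ->
  ((lo c i j = - k \/ lo c i j + e <= lo d i j) /\
   (hi c i j = k \/ hi d i j <= hi c i j - e)) <->
  ((lo c i j = - k \/ lo c i j + e <= k /\ lo c i j + e <= x) /\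
   (hi c i j = k \/ - k <= hi c i j - e /\ y <= hi c i j - e)).
Proof.
move=> e0 -> ->; have c1 := lo_ibox_ge c i j; have c2 := hi_ibox_le c i j.
have lt1 : - k < lo c i j + e by lra.
have lt2 : hi c i j - e < k by lra.
have H1 := le_clamp_iff x lt1; have H2 := clamp_le_iff y lt2.
by tauto.
Qed.

Lemma piece_slackP (w : V1 R K M M1 n) (q Delta : R) (al c : ibox R K n 1)
    (e s t : R) : 0 < e -> q <= s -> s < t ->
  let be := trunc K (boplus al (ratr M%:num * Delta)) in
  let m := bmul (dfld w be) (fld w be) in
  (forall x, s < x <= t -> slack e c (piece w q Delta al x)) <->
  forall i j, piece_slackb e c al (fld w al) m (s - q) (t - q) i j.
Proof.
move=> e0 qs st be m.
have st' : s - q < t - q by lra.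
have st_t : s < t <= t by rewrite st /=.
have tr r : s - q < r <= t - q -> s < r + q <= t.
  by move=> /andP[? ?]; apply/andP; split; lra.
have tr' x : s < x <= t -> s - q < x - q <= t - q.
  by move=> /andP[? ?]; apply/andP; split; lra.
have qlt x : s < x <= t -> q < x by move=> /andP[? _]; lra.
have cl x i j sxt := slack_clamp c e0
  (piece_bounds w Delta al i j (qlt x sxt)).1 (piece_bounds w Delta al i j (qlt x sxt)).2.
split=> [H i j|H x sxt i j].
  have {cl}H x sxt := (cl x i j sxt).1 (H x sxt i j).
  apply/andP; split.
    case: eqP => //= ck.
    (* The exemption does not involve [x], so it is excluded for all [x] at once; the constant test
       is then read off at [t]. *)
    have {}H x (sxt : s < x <= t) := or_ind (fun h => False_ind _ (ck h)) id (H x sxt).1.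
    rewrite (H _ st_t).1 /=; apply/(quad_nonnegP _ _ _ st') => r /tr sr.
    by have [_] := H _ sr; rewrite addrK; clear; lra.
  case: eqP => //= ck.
  have {}H x (sxt : s < x <= t) := or_ind (fun h => False_ind _ (ck h)) id (H x sxt).2.
  rewrite (H _ st_t).1 /=; apply/(quad_nonnegP _ _ _ st') => r /tr sr.
  by have [_] := H _ sr; rewrite addrK; clear; lra.
apply/cl => //; have /andP[/orP H1 /orP H2] := H i j; split.
  case: H1 => [/eqP|/andP[ck /(quad_nonnegP _ _ _ st') /(_ _ (tr' _ sxt)) h]].
    by left.
  by right; split=> //; move: h; clear; lra.
case: H2 => [/eqP|/andP[ck /(quad_nonnegP _ _ _ st') /(_ _ (tr' _ sxt)) h]].
  by left.
by right; split=> //; move: h; clear; lra.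
Qed.

Variable Q : seq rat.
Hypothesis Qpart : is_partition a Q.
Variable t0 : seg R a.

(** [Phi] uses [x] as the default value; a default independent of [x] makes the box at a node
    visibly the same on the whole piece. *)
Definition node (j : nat) : seg R a := insubd t0 (ratr Q`_j).

Lemma node_val j : (j < size Q)%N -> val (node j) = ratr Q`_j.
Proof.
move=> /(node_bound Qpart)/andP[? ?].
by apply: insubdK; rewrite unfold_in/= in_itv/= ler0q ler_rat; apply/andP.
Qed.

Lemma insubd_node (x : seg R a) j : (j < size Q)%N -> insubd x (ratr Q`_j) = node j.
Proof.
move=> jQ; apply: val_inj; rewrite node_val//.
have /andP[? ?] := node_bound Qpart jQ.
by apply: insubdK; rewrite unfold_in/= in_itv/= ler0q ler_rat; apply/andP.
Qed.

Lemma Phi_piece (w : V1 R K M M1 n) phi (x : seg R a) j : (j < (size Q).-1)%N ->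
  ratr Q`_j < val x <= ratr Q`_j.+1 ->
  Phi w Q phi x =
  piece w (ratr Q`_j) (ratr (Q`_j.+1 - Q`_j)) (phi (node j)) (val x).
Proof.
move=> jQ xj; have [Q1 _ _ _] := Qpart.
have jQ' : (j.+1 < size Q)%N by rewrite -(prednK (ltnW Q1)).
by rewrite /Phi (find_piece Qpart jQ' xj) insubd_node// ltnW.
Qed.

(** A step (p, r] meets each piece of [Q] in a possibly empty interval (s, t]. The point 0 belongs
    to no piece and is tested separately. *)
Lemma rep_slack_Phi (w : V1 R K M M1 n) (phi : seg R a -> ibox R K n 1)
    (e : R) N p r b : 0 < e ->
  rep_slack e N p r b (Phi w Q phi) <-> forall l, (l < N)%N ->
    (ratr (p l) < (0 : R) <= ratr (r l) -> slack e (b l) (trunc K (bpoint 0))) /\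
    forall j, (j < (size Q).-1)%N ->
    let q : R := ratr Q`_j in
    let s : R := Num.max (ratr (p l)) q in
    let t : R := Num.min (ratr (r l)) (ratr Q`_j.+1) in
    let al := phi (node j) in
    let be := trunc K (boplus al (ratr M%:num * ratr (Q`_j.+1 - Q`_j))) in
    s < t -> forall i i', piece_slackb e (b l) al (fld w al)
      (bmul (dfld w be) (fld w be)) (s - q) (t - q) i i'.
Proof.
move=> e0; split=> H l lN.
  split=> [pr|j jQ q s t al be st].
    pose x0 := node 0.
    have Q0 : (0 < size Q)%N by have [/ltnW] := Qpart.
    have x00 : val x0 = 0 by rewrite node_val// (node0 Qpart) rmorph0.
    have := H l lN x0; rewrite /Phi (find_zero Qpart x00); apply.
    by rewrite /seg_oc/mkset x00.
  have qs : q <= s by rewrite /s le_max lexx orbT.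
  apply/(piece_slackP _ _ al (b l) e0 qs st) => x /andP[sx xt].
  have [Q1 _ _ _] := Qpart.
  have jQ' : (j.+1 < size Q)%N by rewrite -(prednK (ltnW Q1)).
  have px : ratr (p l) < x by apply: le_lt_trans sx; rewrite le_max lexx.
  have qx : q < x by apply: le_lt_trans sx.
  have xr : x <= ratr (r l) by apply: le_trans xt _; rewrite ge_min lexx.
  have xq : x <= ratr Q`_j.+1 by apply: le_trans xt _; rewrite ge_min lexx orbT.
  have xI : x \in `[0, ratr a]%R.
    have /andP[q0 _] := node_bound Qpart (ltnW jQ').
    have /andP[_ qa] := node_bound Qpart jQ'.
    rewrite in_itv/= (le_trans _ (ltW qx)) ?ler0q//=.
    by rewrite (le_trans xq)// ler_rat.
  have [x' x'x] : exists x' : seg R a, val x' = x.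
    by exists (Sub x xI); exact: SubK.
  have := H l lN x'; rewrite (Phi_piece _ _ jQ) x'x ?qx//.
  by apply; rewrite /seg_oc/mkset x'x px.
move=> x; rewrite /seg_oc/mkset => /andP[px xr].
have [H0 HJ] := H l lN.
have [x0|[j jQ /andP[qx xq]]] := seg_cases Qpart x.
  rewrite /Phi (find_zero Qpart x0); apply: H0.
  by move: px xr; rewrite x0 => -> ->.
rewrite (Phi_piece _ _ jQ) ?qx//.
have sx : Num.max (ratr (p l)) (ratr Q`_j) < val x by rewrite gt_max px.
have xt : val x <= Num.min (ratr (r l)) (ratr Q`_j.+1) by rewrite le_min xr.
have st := lt_le_trans sx xt.
have qs : ratr Q`_j <= Num.max (ratr (p l)) (ratr Q`_j) :> R by rewrite le_max lexx orbT.
apply: (piece_slackP _ _ _ _ e0 qs st).2; last by rewrite sx.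
exact: HJ.
Qed.

End PhiSlack.

(** * Decidability of the approximation *)

Definition box_rec {R : realType} (m p q : nat) (al : seq nat -> box R p q) :=
  forall i j, rational_rec m (fun s => lo (al s) i j) /\
              rational_rec m (fun s => hi (al s) i j).

Section BoxRec.
Context {R : realType}.
Implicit Types (m p q : nat).

Lemma box_rec_subst m m' p q (al : seq nat -> box R p q) e :
  box_rec m' al -> total_env m m' e -> box_rec m (al \o e).
Proof.
move=> alP eP i j; have [H1 H2] := alP i j.
by split; [exact: rational_rec_subst H1 eP|exact: rational_rec_subst H2 eP].
Qed.

Lemma box_rec_span m p q (A A' : seq nat -> 'M[R]_(p, q)) :
  (forall i j, rational_rec m (fun s => A s i j)) ->
  (forall i j, rational_rec m (fun s => A' s i j)) ->
  box_rec m (fun s => bspan (A s) (A' s)).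
Proof.
move=> AP AP' i j; split.
  apply: (rational_rec_ext _ (rational_rec_min (AP i j) (AP' i j))) => s _.
  by rewrite mxE.
apply: (rational_rec_ext _ (rational_rec_max (AP i j) (AP' i j))) => s _.
by rewrite mxE.
Qed.

Lemma rational_rec_clamp m (B : rat) (x : seq nat -> R) :
  rational_rec m x -> rational_rec m (fun s => clamp (ratr B) (x s)).
Proof.
move=> xP; apply: rational_rec_max.
  exact/rational_rec_opp/rational_rec_ratr.
by apply: rational_rec_min => //; exact: rational_rec_ratr.
Qed.

Lemma box_rec_trunc m p q B (al : seq nat -> box R p q) :
  box_rec m al -> box_rec m (fun s => trunc B (al s)).
Proof.
move=> alP; apply: box_rec_span => i j; have [lP hP] := alP i j.
  by apply: (rational_rec_ext _ (rational_rec_clamp B%:num lP)) => s _; rewrite mxE.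
by apply: (rational_rec_ext _ (rational_rec_clamp B%:num hP)) => s _; rewrite mxE.
Qed.

Lemma box_rec_add m p q (al be : seq nat -> box R p q) :
  box_rec m al -> box_rec m be -> box_rec m (fun s => badd (al s) (be s)).
Proof.
move=> alP beP; apply: box_rec_span => i j;
    have [lP hP] := alP i j; have [lP' hP'] := beP i j.
  by apply: (rational_rec_ext _ (rational_rec_add lP lP')) => s _; rewrite mxE.
by apply: (rational_rec_ext _ (rational_rec_add hP hP')) => s _; rewrite mxE.
Qed.

Lemma box_rec_oplus m p q (r : seq nat -> R) (al : seq nat -> box R p q) :
  box_rec m al -> rational_rec m r -> box_rec m (fun s => boplus (al s) (r s)).
Proof.
move=> alP rP; apply: box_rec_add => //; apply: box_rec_span => i j.
  by apply: (rational_rec_ext _ (rational_rec_opp rP)) => s _; rewrite mxE.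
by apply: (rational_rec_ext _ rP) => s _; rewrite mxE.
Qed.

Lemma box_rec_mul m p q r (al : seq nat -> box R p q) (be : seq nat -> box R q r) :
  box_rec m al -> box_rec m be -> box_rec m (fun s => bmul (al s) (be s)).
Proof.
move=> alP beP; apply: box_rec_span => i j.
  apply: (@rational_rec_ext _ _ (fun s => \sum_l imul_lo
    (lo (al s) i l) (hi (al s) i l) (lo (be s) l j) (hi (be s) l j))).
    by move=> s _; rewrite mxE.
  apply: rational_rec_sum => l; have [? ?] := alP i l; have [? ?] := beP l j.
  by apply: rational_rec_min; apply: rational_rec_min; exact: rational_rec_mul.
apply: (@rational_rec_ext _ _ (fun s => \sum_l imul_hi
  (lo (al s) i l) (hi (al s) i l) (lo (be s) l j) (hi (be s) l j))).
  by move=> s _; rewrite mxE.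
apply: rational_rec_sum => l; have [? ?] := alP i l; have [? ?] := beP l j.
by apply: rational_rec_max; apply: rational_rec_max; exact: rational_rec_mul.
Qed.

Lemma box_rec_computable m p q B (c : nat -> nat -> ibox R B p q) f g :
  computable_box c -> total_rec m f -> total_rec m g ->
  box_rec m (fun s => c (f s) (g s)).
Proof.
move=> cP fP gP i j; have [l [h [lP hP H]]] := cP i j; split.
  apply: (rational_rec_ext _ (rational_rec_computable lP fP gP)) => s _.
  by rewrite (H _ _).1.
apply: (rational_rec_ext _ (rational_rec_computable hP fP gP)) => s _.
by rewrite (H _ _).2.
Qed.

(** The number of steps varies with the element, hence the recursive maxima; which steps are active
    at the point is decided by [P]. This serves both for step functions on the segment, at nodes,
    and for those on boxes. *)
Lemma box_rec_step m p q B (X : Type) (N : nat -> nat) (O : nat -> nat -> set X)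
    (c : nat -> nat -> ibox R B p q) (F : nat -> X -> ibox R B p q)
    (f : seq nat -> nat) (x : seq nat -> X) (P : seq nat -> bool) :
  recursive1 N -> computable_box c ->
  (forall i, is_step ble bbot (N i) (O i) (c i) (F i)) ->
  total_rec m f -> decidable_rec m.+1 P ->
  (forall l s, size s = m -> `[< O (f s) l (x s) >] = P (l :: s)) ->
  box_rec m (fun s => F (f s) (x s)).
Proof.
move=> NP cP FP fP PP OP i j.
have f1 : total_rec m.+1 (f \o behead).
  exact: total_rec_subst fP (total_env_behead m).
have c1 := box_rec_computable cP f1 (@total_rec_nth m.+1 0 isT).
have [lP hP] := c1 i j.
have kP m' : rational_rec m' (fun=> ratr B%:num : R) by exact: rational_rec_ratr.
have NfP := total_rec1 NP fP.
split.
  apply: rational_rec_ext (rational_rec_bigmax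
    (rational_rec_if PP lP (rational_rec_opp (kP _))) (rational_rec_opp (kP _)) NfP).
  move=> s sm; rewrite (is_step_lo (x s) i j (FP (f s))).1.
  by apply: eq_bigr => l _; rewrite OP.
apply: rational_rec_ext (rational_rec_bigmin
  (rational_rec_if PP hP (kP _)) (kP _) NfP).
move=> s sm; rewrite (is_step_lo (x s) i j (FP (f s))).2.
by apply: eq_bigr => l _; rewrite OP.
Qed.

Definition interior_subb B p q (c d : ibox R B p q) : bool :=
  [forall i, forall j,
    ((lo c i j == - ratr B%:num) || (lo c i j < lo d i j)) &&
    ((hi c i j == ratr B%:num) || (hi d i j < hi c i j))].

Lemma interior_subP B p q (c d : ibox R B p q) :
  reflect (interior_sub c d) (interior_subb c d).
Proof.
apply: (iffP forallP) => [H i j|H i].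
  have /forallP/(_ j)/andP[/orP H1 /orP H2] := H i.
  by split; [case: H1 => [/eqP|]|case: H2 => [/eqP|]]; [left|right|left|right].
apply/forallP => j; have [H1 H2] := H i j.
apply/andP; split; apply/orP; [case: H1|case: H2] => H'.
- by left; apply/eqP.
- by right.
- by left; apply/eqP.
- by right.
Qed.

Definition slackb B p q (e : R) (c d : ibox R B p q) : bool :=
  [forall i, forall j,
    ((lo c i j == - ratr B%:num) || (lo c i j + e <= lo d i j)) &&
    ((hi c i j == ratr B%:num) || (hi d i j <= hi c i j - e))].

Lemma slackP B p q e (c d : ibox R B p q) : reflect (slack e c d) (slackb e c d).
Proof.
apply: (iffP forallP) => [H i j|H i].
  have /forallP/(_ j)/andP[/orP H1 /orP H2] := H i.
  by split; [case: H1 => [/eqP|]|case: H2 => [/eqP|]]; [left|right|left|right].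
apply/forallP => j; have [H1 H2] := H i j.
apply/andP; split; apply/orP; [case: H1|case: H2] => H'.
- by left; apply/eqP.
- by right.
- by left; apply/eqP.
- by right.
Qed.

Lemma decidable_rec_interior_sub m p q B (c d : seq nat -> ibox R B p q) :
  box_rec m c -> box_rec m d -> decidable_rec m (fun s => interior_subb (c s) (d s)).
Proof.
move=> cP dP; apply: decidable_rec_forall => i; apply: decidable_rec_forall => j.
have [clP chP] := cP i j; have [dlP dhP] := dP i j.
have kP : rational_rec m (fun=> ratr B%:num : R) by exact: rational_rec_ratr.
apply: decidable_rec_and; apply: decidable_rec_or.
- exact: decidable_rec_eqr clP (rational_rec_opp kP).
- exact: decidable_rec_ltr.
- exact: decidable_rec_eqr.
- exact: decidable_rec_ltr.
Qed.

Lemma decidable_rec_slack m p q B e (c d : seq nat -> ibox R B p q) :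
  rational_rec m e -> box_rec m c -> box_rec m d ->
  decidable_rec m (fun s => slackb (e s) (c s) (d s)).
Proof.
move=> eP cP dP; apply: decidable_rec_forall => i; apply: decidable_rec_forall => j.
have [clP chP] := cP i j; have [dlP dhP] := dP i j.
have kP : rational_rec m (fun=> ratr B%:num : R) by exact: rational_rec_ratr.
apply: decidable_rec_and; apply: decidable_rec_or.
- exact: decidable_rec_eqr clP (rational_rec_opp kP).
- by apply: decidable_rec_ler => //; exact: rational_rec_add.
- exact: decidable_rec_eqr.
- by apply: decidable_rec_ler => //; exact: rational_rec_sub.
Qed.

Lemma decidable_rec_quad_nonneg m (A B C u v : seq nat -> R) :
  rational_rec m A -> rational_rec m B -> rational_rec m C ->
  rational_rec m u -> rational_rec m v ->
  decidable_rec m (fun s => quad_nonneg (A s) (B s) (C s) (u s) (v s)).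
Proof.
move=> AP BP CP uP vP.
have natP (k : nat) : rational_rec m (fun=> k%:R : R).
  exact/rational_rec_natr/total_rec_cst.
have zP := natP 0%N.
have val x : rational_rec m x ->
    rational_rec m (fun s => A s + B s * x s + C s * x s ^+ 2).
  move=> xP; apply: rational_rec_add.
    by apply: rational_rec_add => //; exact: rational_rec_mul.
  by apply: rational_rec_mul => //; exact: rational_rec_mul.
have der x : rational_rec m x -> rational_rec m (fun s => B s + 2 * C s * x s).
  move=> xP; apply: rational_rec_add => //; apply: rational_rec_mul => //.
  exact: rational_rec_mul (natP 2%N) CP.
apply: decidable_rec_and; first exact: decidable_rec_ler zP (val _ uP).
apply: decidable_rec_and; first exact: decidable_rec_ler zP (val _ vP).
apply: decidable_rec_or; first exact: decidable_rec_ler CP zP.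
apply: decidable_rec_or; first exact: decidable_rec_ler zP (der _ uP).
apply: decidable_rec_or; first exact: decidable_rec_ler (der _ vP) zP.
apply: decidable_rec_ler; first exact: rational_rec_mul.
by apply: rational_rec_mul => //; exact: rational_rec_mul (natP 4%N) AP.
Qed.

Lemma decidable_rec_piece_slack m (K : {posnum rat}) n (e s t : seq nat -> R)
    (c : seq nat -> ibox R K n 1) (al u w : seq nat -> box R n 1) i j :
  rational_rec m e -> rational_rec m s -> rational_rec m t ->
  box_rec m c -> box_rec m al -> box_rec m u -> box_rec m w ->
  decidable_rec m
    (fun x => piece_slackb (e x) (c x) (al x) (u x) (w x) (s x) (t x) i j).
Proof.
move=> eP sP tP /(_ i j)[clP chP] /(_ i j)[alP ahP] /(_ i j)[ulP uhP] /(_ i j)[wlP whP].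
have kP : rational_rec m (fun=> ratr K%:num : R) by exact: rational_rec_ratr.
have halfP x : rational_rec m x -> rational_rec m (fun s => x s / 2 : R).
  move=> xP; apply: rational_rec_mul => //.
  exact: rational_rec_inv_succ (total_rec_cst m 1).
apply: decidable_rec_and; apply: decidable_rec_or.
- exact: decidable_rec_eqr clP (rational_rec_opp kP).
- apply: decidable_rec_and.
    by apply: decidable_rec_ler => //; exact: rational_rec_add.
  apply: decidable_rec_quad_nonneg => //; last exact: halfP.
  by apply: rational_rec_sub => //; exact: rational_rec_add.
- exact: decidable_rec_eqr.
- apply: decidable_rec_and.
    by apply: decidable_rec_ler; [exact: rational_rec_opp|exact: rational_rec_sub].
  apply: decidable_rec_quad_nonneg => //; try apply: rational_rec_opp => //.
    by apply: rational_rec_sub => //; exact: rational_rec_sub.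
  exact: halfP.
Qed.

End BoxRec.

Lemma exists_inv_succ_lt {R : realType} (e : R) :
  0 < e -> exists m : nat, m.+1%:R^-1 < e.
Proof.
move=> e0; have [m _ /(_ m (leqnn m)) me] := near_infty_natSinv_lt (PosNum e0).
by exists m.
Qed.

(** * Assembling the decision procedure and the search *)

Section Decision.
Context {R : realType} (K M M1 : {posnum rat}) (n : nat) (a : rat).
Variables (v : nat -> V1 R K M M1 n) (b : nat -> seg R a -> ibox R K n 1).
Variables (Q : seq rat) (t0 : seg R a).
Variables (p r : nat -> nat -> rat) (c : nat -> nat -> ibox R K n 1).

(* Variables [l; m; i; j; k]: slackness of the [l]-th step of [b i] below
   [Phi (v k) Q (b j)] with precision [1 / m.+1]. *)
Definition step_slackb (t : seq nat) : bool :=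
  let l := nth 0%N t 0 in let i := nth 0%N t 2 in
  let e : R := (nth 0%N t 1).+1%:R^-1 in
  let pl : R := ratr (p i l) in let rl : R := ratr (r i l) in
  ((pl < 0 <= rl) ==> slackb e (c i l) (trunc K (bpoint 0))) &&
  [forall J : 'I_(size Q).-1,
    let q : R := ratr Q`_J in
    let s := Num.max pl q in let t' := Num.min rl (ratr Q`_J.+1) in
    let al := b (nth 0%N t 3) (node Q t0 J) in
    let w := v (nth 0%N t 4) in
    let be := trunc K (boplus al (ratr M%:num * ratr (Q`_J.+1 - Q`_J))) in
    (s < t') ==> [forall x, [forall y, piece_slackb e (c i l) al (fld w al)
      (bmul (dfld w be) (fld w be)) (s - q) (t' - q) x y]]].

Lemma step_slackbP l m i j k (w : seq nat := [:: l; m; i; j; k]) :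
  step_slackb w <->
  let e : R := m.+1%:R^-1 in
  (ratr (p i l) < (0 : R) <= ratr (r i l) -> slack e (c i l) (trunc K (bpoint 0))) /\
  forall J, (J < (size Q).-1)%N ->
    let q : R := ratr Q`_J in
    let s : R := Num.max (ratr (p i l)) q in
    let t : R := Num.min (ratr (r i l)) (ratr Q`_J.+1) in
    let al := b j (node Q t0 J) in
    let be := trunc K (boplus al (ratr M%:num * ratr (Q`_J.+1 - Q`_J))) in
    s < t -> forall x y, piece_slackb e (c i l) al (fld (v k) al)
      (bmul (dfld (v k) be) (fld (v k) be)) (s - q) (t - q) x y.
Proof.
split=> [/andP[/implyP H0 /forallP HJ]|[H0 HJ]].
  split=> [/H0/slackP//|J JQ q s t al be st x y].
  by have /implyP/(_ st)/forallP/(_ x)/forallP/(_ y) := HJ (Ordinal JQ).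
apply/andP; split; first by apply/implyP => /H0 ?; apply/slackP.
apply/forallP => J; apply/implyP => st; apply/forallP => x; apply/forallP => y.
exact: HJ.
Qed.

Hypothesis Qpart : is_partition a Q.
Variables (NB N N' : nat -> nat).
Variables (d : nat -> nat -> ibox R K n 1) (f : nat -> nat -> ibox R M n 1).
Variables (d' : nat -> nat -> ibox R K n 1) (f' : nat -> nat -> ibox R M1 n n).
Hypotheses (NBP : recursive1 NB) (NP : recursive1 N) (N'P : recursive1 N').
Hypotheses (pP : computable_rat p) (rP : computable_rat r).
Hypotheses (cP : computable_box c) (dP : computable_box d)
  (fP : computable_box f) (d'P : computable_box d') (f'P : computable_box f').
Hypothesis bP : forall i, BD_rep (NB i) (p i) (r i) (c i) (b i).
Hypothesis vP : forall i, V1_rep (N i) (d i) (f i) (fld (v i)).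
Hypothesis v'P : forall i, V1_rep (N' i) (d' i) (f' i) (dfld (v i)).

(** Nodes are rational, so two comparisons of rationals settle whether a step is active. *)
Lemma box_rec_BD m g J : (J < size Q)%N -> total_rec m g ->
  box_rec m (fun s => b (g s) (node Q t0 J)).
Proof.
move=> JQ gP.
have g1 : total_rec m.+1 (g \o behead).
  exact: total_rec_subst gP (total_env_behead m).
have l1 := @total_rec_nth m.+1 0 isT.
have qP : rational_rec m.+1 (fun=> ratr Q`_J : R) by exact: rational_rec_ratr.
apply: (@box_rec_step R m n 1 K _ NB (fun i l => seg_oc (p i l) (r i l)) c b
  g (fun=> node Q t0 J) (fun t => (ratr (p (g (behead t)) (nth 0%N t 0)) <
    (ratr Q`_J : R)) && ((ratr Q`_J : R) <= ratr (r (g (behead t)) (nth 0%N t 0))))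
  NBP cP) => //.
- by move=> i; case: (bP i).
- apply: decidable_rec_and.
    exact: decidable_rec_ltr (rational_rec_computable pP g1 l1) qP.
  exact: decidable_rec_ler qP (rational_rec_computable rP g1 l1).
- by move=> l s sm; rewrite /seg_oc /mkset node_val// asboolb.
Qed.

(** By [bway_belowP], membership in a way-above set amounts to finitely many comparisons of
    bounds. *)
Lemma box_rec_fld m g (al : seq nat -> ibox R K n 1) : total_rec m g -> box_rec m al ->
  box_rec m (fun s => fld (v (g s)) (al s)).
Proof.
move=> gP alP.
have g1 : total_rec m.+1 (g \o behead).
  exact: total_rec_subst gP (total_env_behead m).
have l1 := @total_rec_nth m.+1 0 isT.
apply: (@box_rec_step R m n 1 M _ N (fun i l => [set al | bway_below (d i l) al])
  f (fun i => fld (v i)) g al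
  (fun t => interior_subb (d (g (behead t)) (nth 0%N t 0)) (al (behead t)))
  NP fP) => //.
- by move=> i; case: (vP i).
- apply: decidable_rec_interior_sub; first exact: box_rec_computable dP g1 l1.
  exact: box_rec_subst alP (total_env_behead m).
- move=> l s sm; apply/asboolP/interior_subP => /bway_belowP//.
Qed.

Lemma box_rec_dfld m g (al : seq nat -> ibox R K n 1) : total_rec m g -> box_rec m al ->
  box_rec m (fun s => dfld (v (g s)) (al s)).
Proof.
move=> gP alP.
have g1 : total_rec m.+1 (g \o behead).
  exact: total_rec_subst gP (total_env_behead m).
have l1 := @total_rec_nth m.+1 0 isT.
apply: (@box_rec_step R m n n M1 _ N' (fun i l => [set al | bway_below (d' i l) al])
  f' (fun i => dfld (v i)) g al
  (fun t => interior_subb (d' (g (behead t)) (nth 0%N t 0)) (al (behead t)))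
  N'P f'P) => //.
- by move=> i; case: (v'P i).
- apply: decidable_rec_interior_sub; first exact: box_rec_computable d'P g1 l1.
  exact: box_rec_subst alP (total_env_behead m).
- move=> l s sm; apply/asboolP/interior_subP => /bway_belowP//.
Qed.

Lemma decidable_rec_step_slackb : decidable_rec 5 step_slackb.
Proof.
have nP i : (i < 5)%N -> total_rec 5 (fun s => nth 0%N s i).
  exact: total_rec_nth.
have eP : rational_rec 5 (fun s => (nth 0%N s 1).+1%:R^-1 : R).
  exact/rational_rec_inv_succ/nP.
have plP : rational_rec 5 (fun s => ratr (p (nth 0%N s 2) (nth 0%N s 0)) : R).
  by apply: rational_rec_computable; [|exact: nP..].
have rlP : rational_rec 5 (fun s => ratr (r (nth 0%N s 2) (nth 0%N s 0)) : R).
  by apply: rational_rec_computable; [|exact: nP..].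
have clP : box_rec 5 (fun s => c (nth 0%N s 2) (nth 0%N s 0)).
  by apply: box_rec_computable; [|exact: nP..].
have cstP (q : rat) : rational_rec 5 (fun=> ratr q : R) by exact: rational_rec_ratr.
have zeroP : rational_rec 5 (fun=> 0 : R).
  by apply: (rational_rec_ext _ (cstP 0)) => s _; rewrite rmorph0.
apply: decidable_rec_and.
  apply: decidable_rec_imp.
    apply: decidable_rec_and.
      exact: decidable_rec_ltr plP zeroP.
    exact: decidable_rec_ler zeroP rlP.
  apply: decidable_rec_slack => //; apply: box_rec_trunc; apply: box_rec_span => i j;
    by apply: (rational_rec_ext _ zeroP) => s _; rewrite mxE.
apply: decidable_rec_forall => J.
have JQ : (J < size Q)%N by apply: leq_trans (ltn_ord J) (leq_pred _).
have alP : box_rec 5 (fun s => b (nth 0%N s 3) (node Q t0 J)).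
  by apply: box_rec_BD => //; exact: nP.
have beP : box_rec 5 (fun s => trunc K (boplus (b (nth 0%N s 3) (node Q t0 J))
    (ratr M%:num * ratr (Q`_J.+1 - Q`_J)))).
  by apply: box_rec_trunc; apply: box_rec_oplus => //; exact: rational_rec_mul.
have sP := rational_rec_max plP (cstP Q`_J).
have tP := rational_rec_min rlP (cstP Q`_J.+1).
apply: decidable_rec_imp; first exact: decidable_rec_ltr sP tP.
apply: decidable_rec_forall => x; apply: decidable_rec_forall => y.
apply: decidable_rec_piece_slack => //.
- exact: rational_rec_sub sP (cstP _).
- exact: rational_rec_sub tP (cstP _).
- by apply: box_rec_fld => //; exact: nP.
- apply: box_rec_mul; [apply: box_rec_dfld|apply: box_rec_fld] => //; exact: nP.
Qed.

(** A smaller margin is easier to meet, so it suffices to search among the inverses of positive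
    integers. *)
Lemma lowstar_PhiP i j k : lowstar (Phi (v k) Q (b j)) (b i) <->
  exists m, [forall l : 'I_(NB i), step_slackb [:: val l; m; i; j; k]].
Proof.
have e0 m : 0 < m.+1%:R^-1 :> R by rewrite invr_gt0 ltr0n.
have H m : rep_slack (m.+1%:R^-1 : R) (NB i) (p i) (r i) (c i) (Phi (v k) Q (b j)) <->
    [forall l : 'I_(NB i), step_slackb [:: val l; m; i; j; k]].
  apply: iff_trans (rep_slack_Phi Qpart t0 _ _ _ _ _ _ (e0 m)) _.
  split=> [H|/forallP H l lN].
    by apply/forallP => l; apply/step_slackbP; exact: (H _ (ltn_ord l)).
  exact: (step_slackbP _ _ _ _ _).1 (H (Ordinal lN)).
apply: iff_trans (lowstarP _ (bP i)) _; split=> [[e e1 He]|[m /H Hm]].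
  have e2 : 0 < ratr e :> R by rewrite ltr0q.
  have [m me] := exists_inv_succ_lt e2.
  exists m; apply/H => l lN t tl; apply: slack_le (He l lN t tl); exact: ltW.
exists m.+1%:R^-1; first by rewrite invr_gt0 ltr0n.
by move=> l lN t tl; rewrite fmorphV/= ratr_nat; exact: Hm.
Qed.

Lemma re3_lowstar_Phi :
  re3 (fun i j k => lowstar (Phi (v k) Q (b j)) (b i)).
Proof.
have P1 : total_rec 4 (fun s => NB (nth 0%N s 1)).
  exact: total_rec1 NBP (@total_rec_nth 4 1 isT).
have [code codeP] := re3_exists (decidable_rec_all decidable_rec_step_slackb P1).
exists code => i j k; rewrite -codeP; exact: lowstar_PhiP.
Qed.

End Decision.

Theorem theorem5p15 (R : realType) (n : nat) (K M M1 : {posnum rat}) (a : rat)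
    (v : nat -> V1 R K M M1 n) (b : nat -> seg R a -> ibox R K n 1)
    (Q : seq rat) :
  (0 < n)%N ->
  0 < a <= K%:num / (M%:num * (1 + n%:R * M1%:num)) ->
  V1_enum v -> BD_enum b -> is_partition a Q ->
  (forall (w : V1 R K M M1 n) phi,
     WD R K n a phi -> WD R K n a (F Q w phi)) /\
  computable2 (WD R K n a) subset v (fun j => iD (b j)) (fun i => iD (b i))
    (F Q).
Proof.
move=> _ /andP[a0 _] [_ _ [N [d [f [NP dP fP vP]]]] [N' [d' [f' [N'P d'P f'P v'P]]]]].
move=> [_ _ _ [NB [p [r [c [NBP pP rP cP bP]]]]]] Qpart.
split=> [w phi _|]; first exact: lowstar_WD.
(* The default for [node]: 0 lies in the segment because [a] is positive. *)
have t0 : seg R a.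
  by exists 0; rewrite in_itv/= lexx ler0q ltW.
have [code codeP] :=
  re3_lowstar_Phi t0 Qpart NBP NP N'P pP rP cP dP fP d'P f'P bP vP v'P.
exists code => i j k; rewrite -codeP.
have Bb l : BD R K n a (b l) by exact: BD_rep_BD (bP l).
apply: iff_trans (iD_way_below (Bb i) (lowstar_WD _)) _.
by rewrite (upstar_iD (Bb j)).
Qed.
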